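(* Let $\alpha\ge2$ and $1\le r\le\lfloor\alpha/2\rfloor$. Assume that $a^0$ and $\{a^{2s},b^{2s}\}_{s=1}^{r-1}$ have already been computed (satisfying requirements (i)–(iv) of the context for each index $s\le r-1$), and let $\check q^r\in\mathrm{Sym}^{2r+2}(\mathbb{R}^d)$ be $$\check q^1=S^4(-g^2),\qquad \check q^r=S^{2r+2}\Big((-1)^rg^{2r}+\sum_{\ell=1}^{r-1}c^\ell\otimes b^{2(r-\ell)}\Big)\quad(r\ge2).$$ Define $$A^r=M\big(S^{2r+2}(\otimes^{r+1}a^0)\big),\qquad \delta^*=\Big\{-\frac{\lambda_{\min}(M(\check q^r))}{\lambda_{\min}(A^r)}\Big\}_+,\qquad R=\delta^*S^{2r}(\otimes^ra^0),$$ where $\lambda_{\min}(\cdot)$ is the minimal eigenvalue of a symmetric matrix and $\{\cdot\}_+=\max\{0,\cdot\}$. Then the tensors $$a^{2r}=\check q^r+S^{2r+2}(R\otimes a^0),\qquad b^{2r}=R,$$ satisfy the following requirements: (i) $a^{2r}\in\mathrm{Ten}^{2r+2}(\mathbb{R}^d)$ and $b^{2r}\in\mathrm{Ten}^{2r}(\mathbb{R}^d)$; (ii) $a^{2r}$ and $b^{2r}$ are positive semidefinite; (iii) $a^{2r}$ and $b^{2r}$ satisfy the major symmetries; (iv) $a^{2r}-b^{2r}\otimes a^0=_S\check q^r$.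
   Context: Setting. $Y=(0,\ell_1)\times\cdots\times(0,\ell_d)$; $a(y)$ is a $d\times d$ symmetric $Y$-periodic tensor with $\lambda|\xi|^2\le a(y)\xi\cdot\xi\le\Lambda|\xi|^2$ for all $\xi\in\mathbb{R}^d$, a.e. $y$ ($\lambda,\Lambda>0$). $W_{\mathrm{per}}(Y)$ is the space of zero-mean functions of $H^1_{\mathrm{per}}(Y)$. $(\cdot,\cdot)_Y$ is the $L^2(Y)$ inner product, $e_i$ the canonical basis. Tensors. $\mathrm{Ten}^n(\mathbb{R}^d)$: tensors of order $n$; $\mathrm{Sym}^n(\mathbb{R}^d)$: fully symmetric ones; repeated indices are summed. $(S^n(q))_{i_1\cdots i_n}=\frac1{n!}\sum_{\sigma}q_{i_{\sigma(1)}\cdots i_{\sigma(n)}}$ (all permutations), also written $S^n_{i_1\cdots i_n}\{q_{i_1\cdots i_n}\}$; $p=_Sq$ means $S^n(p)=S^n(q)$. $(p\otimes q)_{i_1\cdots i_{m+n}}=p_{i_1\cdots i_m}q_{i_{m+1}\cdots i_{m+n}}$; $\otimes^sq=q\otimes\cdots\otimes q$ ($s$ times). $q\in\mathrm{Ten}^{2n}$ has the major symmetry if $q_{i_1\cdots i_{2n}}=q_{i_{n+1}\cdots i_{2n}i_1\cdots i_n}$; it is positive semidefinite if $q_{i_1\cdots i_{2n}}\xi_{i_1\cdots i_n}\xi_{i_{n+1}\cdots i_{2n}}\ge0$ for all $\xi\in\mathrm{Sym}^n(\mathbb{R}^d)$. Correctors. Set $\chi^0=1$ and let $\chi^1_i\in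 W_{\mathrm{per}}(Y)$ solve $(a\nabla_y\chi^1_i,\nabla_yw)_Y=-(ae_i,\nabla_yw)_Y$ for all $w\in W_{\mathrm{per}}(Y)$. Inductively, for $m\ge0$ let $$g^m_{i_1\cdots i_{m+2}}=\tfrac1{|Y|}\big(a(\nabla_y\chi^{m+1}_{i_2\cdots i_{m+2}}+e_{i_2}\chi^m_{i_3\cdots i_{m+2}}),e_{i_1}\big)_Y,\qquad p^m=g^m\ (m\text{ even}),\quad p^m=0\ (m\text{ odd}),$$ and for $k\ge1$ let the symmetric tensor $\chi^{k+1}$ have components in $W_{\mathrm{per}}(Y)$ such that for all $w\in H^1_{\mathrm{per}}(Y)$ $$(a\nabla_y\chi^{k+1}_{i_1\cdots i_{k+1}},\nabla_yw)_Y=S^{k+1}_{i_1\cdots i_{k+1}}\Big\{-(ae_{i_1}\chi^k_{i_2\cdots i_{k+1}},\nabla_yw)_Y+\big(a(\nabla_y\chi^k_{i_2\cdots i_{k+1}}+e_{i_2}\chi^{k-1}_{i_3\cdots i_{k+1}}),e_{i_1}w\big)_Y-\sum_{j=0}^{k-1}\big((p^{k-1-j}\otimes\chi^j)_{i_1\cdots i_{k+1}},w\big)_Y\Big\}.$$ (These problems are uniquely solvable; for odd $m$ it is known that $g^m=_S0$.) The homogenized tensor is $a^0=g^0$, a symmetric positive definite matrix. The tensors $c^\ell$ are $c^0=a^0$, $c^\ell=a^{2\ell}-\sum_{m=0}^{\ell-1}c^m\otimes b^{2(\ell-m)}$ for $1\le\ell\le r-1$. Requirements (i)–(iv) for an index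 $s$ are those listed in the claim with $r$ replaced by $s$. Matricization operator $M$. Let $I(d,n)=\{(i_1,\dots,i_n):1\le i_1\le\cdots\le i_n\le d\}$, $N(d,n)=|I(d,n)|=\binom{d+n-1}{n}$, and fix a bijection $\ell:\{1,\dots,N(d,n)\}\to I(d,n)$. For $i\in I(d,n)$ let $z(i)$ be the number of multi-indices in $\{1,\dots,d\}^n$ that are permutations of $i$. Then $M:\mathrm{Sym}^{2n}(\mathbb{R}^d)\to\mathrm{Sym}^2(\mathbb{R}^{N(d,n)})$ is $(M(q))_{\rho\sigma}=z(\ell(\rho))\,z(\ell(\sigma))\,q_{\ell(\rho)\ell(\sigma)}$, where $\ell(\rho)\ell(\sigma)$ is the concatenated multi-index. Here it is used with $n=r+1$. *)

(* Defs.v *)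
From HB Require Import structures.
From mathcomp Require Import all_boot all_order all_algebra perm.
From mathcomp Require Import all_classical all_reals all_analysis.

Set Implicit Arguments.
Unset Strict Implicit.
Unset Printing Implicit Defensive.

Import Order.TTheory GRing.Theory Num.Theory numFieldNormedType.Exports.

Local Open Scope classical_set_scope.
Local Open Scope ring_scope.

(* R^n, with the product Borel sigma-algebra of tuples. *)
Notation Rn R n := (n.-tuple (measurableTypeR R)).

Section lebesgue_cons.
Context {R : realType} {n : nat}.
Variable m : {sigma_finite_measure set (Rn R n) -> \bar R}.

Definition consR (p : measurableTypeR R * Rn R n) : Rn R n.+1 :=
  [tuple of p.1 :: p.2].

Lemma measurable_consR :
  measurable_fun [set: measurableTypeR R * Rn R n] consR.
Proof.
by apply: measurable_cons; [exact: measurable_fst|exact: measurable_snd].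
Qed.

Definition lebesgue_cons : set (Rn R n.+1) -> \bar R :=
  pushforward (product_measure1 lebesgue_measure m) consR.

Let lebesgue_cons0 : lebesgue_cons set0 = 0%E.
Proof. by rewrite /lebesgue_cons /pushforward preimage_set0 measure0. Qed.

Let lebesgue_cons_ge0 A : (0 <= lebesgue_cons A)%E.
Proof. by rewrite /lebesgue_cons /pushforward; exact: measure_ge0. Qed.

Let lebesgue_cons_sigma_additive : semi_sigma_additive lebesgue_cons.
Proof.
exact: (@measure_semi_sigma_additive _ _ _
  (measure_function_pushforward__canonical__measure_function_Measure
     (product_measure1 lebesgue_measure m) measurable_consR)).
Qed.

HB.instance Definition _ := isMeasure.Build _ _ _ lebesgue_cons
  lebesgue_cons0 lebesgue_cons_ge0 lebesgue_cons_sigma_additive.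

Let lebesgue_cons_sigma_finite : sigma_finite setT lebesgue_cons.
Proof.
have /sigma_finiteP[F [FT ndF Foo]] := sigma_finiteT (@lebesgue_measure R).
have /sigma_finiteP[G [GT ndG Goo]] := sigma_finiteT m.
pose unconsR (v : Rn R n.+1) : measurableTypeR R * Rn R n :=
  (tnth v ord0, [tuple of behead v]).
have consRK : cancel consR unconsR.
  by move=> [t v]; congr pair; apply/val_inj.
have munconsR : measurable_fun [set: Rn R n.+1] unconsR.
  apply/measurable_fun_pairP; split; first exact: measurable_tnth.
  exact: measurable_behead.
exists (fun k => unconsR @^-1` (F k `*` G k)).
  apply/esym; rewrite -subTset => v _.
  have [k _ Fk] : (\bigcup_k F k) (tnth v ord0) by rewrite -FT.
  have [l _ Gl] : (\bigcup_k G k) [tuple of behead v] by rewrite -GT.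
  exists (maxn k l) => //; split => /=.
    by move: Fk; exact/subsetPset/ndF/leq_maxl.
  by move: Gl; exact/subsetPset/ndG/leq_maxr.
move=> k; have [mF Fk] := Foo k; have [mG Gk] := Goo k; split.
  by rewrite -[X in measurable X]setTI; apply: munconsR => //; exact: measurableX.
rewrite /lebesgue_cons /pushforward -comp_preimage.
rewrite (_ : unconsR \o consR = id); last by rewrite funeqE => p /=; rewrite consRK.
by rewrite preimage_id product_measure1E// lte_mul_pinfty// ge0_fin_numE.
Qed.

HB.instance Definition _ := Measure_isSigmaFinite.Build _ _ _ lebesgue_cons
  lebesgue_cons_sigma_finite.

End lebesgue_cons.

(* Lebesgue measure on R^n: the n-fold product of lebesgue_measure. *)
Fixpoint lebesgueRn (R : realType) (n : nat) :
    {sigma_finite_measure set (Rn R n) -> \bar R} :=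
  if n is n'.+1 then lebesgue_cons (lebesgueRn R n')
  else dirac ([tuple] : Rn R 0).

Section cell.
Context {R : realType} {d : nat}.
Variable ell : 'I_d -> R.
Implicit Types (u w : Rn R d -> R) (F G : Rn R d -> 'cV[R]_d).
Implicit Types phi : 'rV[R]_d -> R.

Definition cell : set (Rn R d) :=
  [set y | forall i, (0 < (tnth y i : R)) && ((tnth y i : R) < ell i)].

Definition cell_volume : R := \prod_i ell i.

Definition basis_vec (i : 'I_d) : 'cV[R]_d := delta_mx i 0.

Definition dotv (x y : 'cV[R]_d) : R := \sum_i x i 0 * y i 0.

Definition inner u w : R := \int[lebesgueRn R d]_(y in cell) (u y * w y).

Definition innerv F G : R :=
  \int[lebesgueRn R d]_(y in cell) dotv (F y) (G y).

Definition in_L2 u : Prop :=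
  measurable_fun cell u /\
  (\int[lebesgueRn R d]_(y in cell) ((u y) ^+ 2)%:E < +oo)%E.

(* Test functions live on 'rV[R]_d, where the library has derivatives. *)
Definition rv_of (y : Rn R d) : 'rV[R]_d := \row_i tnth y i.

Definition partial (i : 'I_d) phi : 'rV[R]_d -> R :=
  fun x => 'D_(delta_mx 0 i) phi x.

Definition partials (s : seq 'I_d) phi : 'rV[R]_d -> R := foldr partial phi s.

Definition smooth phi : Prop := forall s : seq 'I_d,
  (forall x : 'rV[R]_d, {for x, continuous (partials s phi)}) /\
  (forall i (x : 'rV[R]_d), derivable (partials s phi) x (delta_mx 0 i)).

Definition periodic_rv phi : Prop :=
  forall i (x : 'rV[R]_d), phi (x + ell i *: delta_mx 0 i) = phi x.

(* G is the gradient of u in H^1_per(Y): the periodicity of u, including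
   that of its trace on the boundary of Y, is encoded in the fact that the test
   functions are periodic and need not vanish on the boundary. *)
Definition is_grad u G : Prop :=
  (forall i, in_L2 (fun y => G y i 0)) /\
  (forall phi, smooth phi -> periodic_rv phi -> forall i,
     inner u (fun y => partial i phi (rv_of y)) =
     - inner (fun y => G y i 0) (fun y => phi (rv_of y))).

Definition H1per u : Prop := in_L2 u /\ exists G, is_grad u G.

Definition Wper u : Prop :=
  H1per u /\ \int[lebesgueRn R d]_(y in cell) u y = 0.

(* The gradient is only determined almost everywhere: this picks a
   representative. *)
Definition grad u : Rn R d -> 'cV[R]_d :=
  xget (fun=> 0) [set G | is_grad u G].

Definition shift_cell (i : 'I_d) (y : Rn R d) : Rn R d :=
  [tuple (tnth y j : R) + ell i *+ (j == i) | j < d].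

Definition elliptic_periodic (lambda Lambda : R) (a : Rn R d -> 'M[R]_d) : Prop :=
  [/\ forall i j, measurable_fun setT (fun y => a y i j),
      {ae lebesgueRn R d, forall y, (a y)^T = a y},
      forall i, {ae lebesgueRn R d, forall y, a (shift_cell i y) = a y} &
      {ae lebesgueRn R d, forall y, forall xi : 'cV[R]_d,
         lambda * dotv xi xi <= dotv (a y *m xi) xi <= Lambda * dotv xi xi}].

End cell.

Section tensor.
Context {R : realType} {d : nat}.

Definition Ten (n : nat) : Type := {ffun n.-tuple 'I_d -> R}.

Definition permt n (s : 'S_n) (i : n.-tuple 'I_d) : n.-tuple 'I_d :=
  [tuple tnth i (s k) | k < n].

Definition is_sym n (q : Ten n) : Prop := forall s i, q (permt s i) = q i.

Definition symT n (q : Ten n) : Ten n :=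
  [ffun i => (n`!%:R)^-1 * \sum_(s : 'S_n) q (permt s i)].

Definition eq_sym n (p q : Ten n) : Prop := symT p = symT q.

Definition otimes m n (p : Ten m) (q : Ten n) : Ten (m + n) :=
  [ffun i => p [tuple tnth i (lshift n k) | k < m] *
             q [tuple tnth i (rshift m k) | k < n]].

Definition castT m n (e : m = n) (p : Ten m) : Ten n :=
  [ffun i => p (tcast (esym e) i)].

Fixpoint tenpow n (q : Ten n) (s : nat) : Ten (s * n) :=
  if s is s'.+1 then otimes q (tenpow q s') else [ffun=> 1].

(* Tensors of even order 2n are indexed by n * 2, so that (n+1) * 2 reduces to
   n * 2 + 2; cat2 i j is the concatenated multi-index. *)
Definition cat2 n (i j : n.-tuple 'I_d) : (n * 2).-tuple 'I_d :=
  tcast (etrans (addnn n) (esym (muln2 n))) [tuple of i ++ j].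

Definition major_sym n (q : Ten (n * 2)) : Prop :=
  forall i j : n.-tuple 'I_d, q (cat2 i j) = q (cat2 j i).

Definition pos_semidef n (q : Ten (n * 2)) : Prop :=
  forall xi : Ten n, is_sym xi ->
    0 <= \sum_i \sum_j q (cat2 i j) * xi i * xi j.

End tensor.
Arguments Ten : clear implicits.

Definition sorted_index (d n : nat) (i : n.-tuple 'I_d) : bool :=
  sorted leq [seq val k | k <- i].

(* I(d,n), so that N(d,n) is #|{: Idx d n}| *)
Notation Idx d n := {i : n.-tuple 'I_d | sorted_index i}.

Section matricization.
Context {R : realType} {d n : nat}.

Definition mult_index (i : n.-tuple 'I_d) : nat :=
  #|[pred j : n.-tuple 'I_d | perm_eq j i]|.

Definition matricize (l : 'I_#|{: Idx d n}| -> Idx d n) (q : Ten R d (n * 2)) :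
    'M[R]_#|{: Idx d n}| :=
  \matrix_(rho, sigma)
    ((mult_index (val (l rho)))%:R * (mult_index (val (l sigma)))%:R *
     q (cat2 (val (l rho)) (val (l sigma)))).

End matricization.

(* The infimum is a minimum when A is symmetric and N > 0. *)
Definition lambda_min (R : realType) (N : nat) (A : 'M[R]_N) : R :=
  inf [set x | eigenvalue A x].

Section correctors.
Context {R : realType} {d : nat}.
Variables (ell : 'I_d -> R) (a : Rn R d -> 'M[R]_d).
Variable chi : forall k : nat, Rn R d -> Ten R d k.

Definition chi_comp k (i : k.-tuple 'I_d) : Rn R d -> R := fun y => chi k y i.

Definition tail n (i : n.+1.-tuple 'I_d) : n.-tuple 'I_d :=
  [tuple of behead i].

(* a (grad chi^{m+1}_{i_2..i_{m+2}} + e_{i_2} chi^m_{i_3..i_{m+2}}) *)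
Definition flux m (i : m.+2.-tuple 'I_d) : Rn R d -> 'cV[R]_d := fun y =>
  a y *m (grad ell (chi_comp (tail i)) y +
          chi_comp (tail (tail i)) y *: basis_vec (thead (tail i))).

Definition gT m : Ten R d m.+2 :=
  [ffun i => (cell_volume ell)^-1 *
             innerv ell (flux i) (fun=> basis_vec (thead i))].

Definition pT m : Ten R d m.+2 := if odd m then 0 else gT m.

Lemma corr_order m (j : 'I_m.+1) : ((m - j).+2 + j)%N = m.+2.
Proof. by rewrite !addSn subnK// -ltnS. Qed.

Definition corr_rhs m (w : Rn R d -> R) : Ten R d m.+2 :=
  symT [ffun i : m.+2.-tuple 'I_d =>
    - innerv ell (fun y => a y *m (chi_comp (tail i) y *: basis_vec (thead i)))
                 (grad ell w)
    + innerv ell (flux i) (fun y => w y *: basis_vec (thead i))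
    - \sum_(j < m.+1)
        inner ell (fun y => castT (corr_order j) (otimes (pT (m - j)) (chi j y)) i)
                  w].

Definition correctors : Prop :=
  [/\ forall y i, chi 0 y i = 1,
      forall i, Wper ell (chi_comp i) /\ forall w, Wper ell w ->
        innerv ell (fun y => a y *m grad ell (@chi_comp 1 i) y) (grad ell w) =
        - innerv ell (fun y => a y *m basis_vec (thead i)) (grad ell w) &
      forall m,
        {ae lebesgueRn R d, forall y, cell ell y -> is_sym (chi m.+2 y)} /\
        forall i : m.+2.-tuple 'I_d, Wper ell (chi_comp i) /\
          forall w, H1per ell w ->
            innerv ell (fun y => a y *m grad ell (chi_comp i) y) (grad ell w) =
            corr_rhs m w i].

End correctors.

Section effective.
Context {R : realType} {d : nat}.
Variable g : forall m : nat, Ten R d m.+2.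
Variables (c : forall s : nat, Ten R d (s.+1 * 2))
          (aa : forall s : nat, Ten R d (s.+1 * 2))
          (bb : forall s : nat, Ten R d (s * 2)).

Let a0 : Ten R d (1 * 2) := g 0.

Lemma cb_order r (l : 'I_r) : (l.+1 * 2 + (r - l) * 2)%N = (r.+1 * 2)%N.
Proof. by rewrite -mulnDl addSn subnKC// ltnW. Qed.

Lemma ba_order r : (r * 2 + 2)%N = (r.+1 * 2)%N.
Proof. by rewrite addnC. Qed.

Definition c_tensors (r : nat) : Prop :=
  c 0 = a0 /\ forall l, (1 <= l < r)%N ->
    c l = aa l - \sum_(m < l) castT (cb_order m) (otimes (c m) (bb (l - m))).

(* The sum is empty for r = 1. *)
Definition q_check (r : nat) : Ten R d (r.+1 * 2) :=
  symT ((-1) ^+ r *: (g (r * 2) : Ten R d (r.+1 * 2)) +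
        \sum_(l < r | (0 < l)%N) castT (cb_order l) (otimes (c l) (bb (r - l)))).

(* Requirement (i), on the orders, is carried by the types of A and B. *)
Definition requirements (r : nat) (A : Ten R d (r.+1 * 2)) (B : Ten R d (r * 2)) :
    Prop :=
  [/\ pos_semidef A /\ pos_semidef B,
      major_sym A /\ major_sym B &
      eq_sym (A - castT (ba_order r) (otimes B a0)) (q_check r)].

End effective.

(* Main.v *)
Require Import Defs.
From HB Require Import structures.
From mathcomp Require Import all_boot all_order all_algebra perm.
From mathcomp Require Import all_classical all_reals all_analysis.
From mathcomp Require Import measurable_realfun.
From mathcomp Require Import zify ring lra.

Set Implicit Arguments.
Unset Strict Implicit.
Unset Printing Implicit Defensive.

Import Order.TTheory GRing.Theory Num.Theory numFieldNormedType.Exports.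

Local Open Scope classical_set_scope.
Local Open Scope ring_scope.

(** Everything rests on one positivity fact: when [a0] is symmetric positive
    definite, the symmetrized power [S(a0 (x) ... (x) a0)] with [n] factors is a
    positive definite quadratic form on symmetric tensors of order [n]
    ([quad_form_tenpow_gt0]).

    Granting it, the tensor [b] is a nonnegative multiple of such a form.
    An inner symmetrization is absorbed by an outer one ([symT_otimesl]), so the
    tensor added to [q] is [delta] times the symmetrized power with [r + 1]
    factors ([symT_tenpow_left]).  Matricization turns the quadratic form of a
    fully symmetric tensor on symmetric tensors into the quadratic form of a
    matrix ([quad_form_matricize]); it is bounded below by the smallest
    eigenvalue ([rayleigh]), and [delta] is exactly large enough for
    [lambda_min (M q) + delta * lambda_min A] to be nonnegative
    ([quad_form_shift_ge0]).  The division by [lambda_min A] is harmless because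
    the positivity fact makes this eigenvalue positive
    ([lambda_min_matricize_gt0]).  Both tensors are fully symmetric, which gives
    the major symmetries, and the last requirement is linearity and idempotence
    of [S].

    For the positivity fact, a factorization [a0 = B^T B] ([cholesky]) reduces
    [a0] to the identity, since multiplying every index by [B] commutes with
    symmetrization.  By Wick's formula the symmetrized power of the identity
    is, up to a positive constant, the tensor whose entry at [w] is the moment
    [E (X_(w 1) ... X_(w 2n))] of a standard Gaussian vector
    ([symT_tenpow_kron]); this entry is the product over the coordinates [x] of
    the one-dimensional moment of order the multiplicity of [x] in [w].
    Expanding powers in Hermite polynomials, which are orthogonal with squared
    norms [l!], writes the moment of order [j + k] as the sum over [l] of
    [l! h(j,l) h(k,l)] ([gauss_momentD]).  The form is therefore a sum of
    squares with positive weights ([quad_form_moment]), and the squares of top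
    degree contain each entry of the tensor, whence definiteness.

    Finally [a0] is symmetric positive definite because of the cell problem.
    Put [F_j = grad chi_j + e_j].  The weak equation says that [a F_j] is
    orthogonal to all [grad chi_i] ([energy_flow_grad]), hence the entry [(i,j)]
    of [a0] is the mean of [a F_j . F_i], which is symmetric.  A combination
    [F_v] of the [F_j] has mean [v], because gradients of periodic functions
    have mean zero, and integrating [|F_v|^2 >= 2 v . F_v - |v|^2] bounds the
    form of [a0] at [v] below by [lambda |v|^2] ([energy_ge]). *)

Local Notation is_sym := Defs.is_sym.

(** * Symmetrization of tensors *)

Section tensor_symmetrization.
Context {R : realType} {d : nat}.
Implicit Types m n : nat.

Lemma permt_comp n (s t : 'S_n) (i : n.-tuple 'I_d) :
  permt t (permt s i) = permt (t * s)%g i.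
Proof. by apply: eq_from_tnth => k; rewrite !tnth_mktuple permM. Qed.

Lemma permt1 n (i : n.-tuple 'I_d) : permt 1 i = i.
Proof. by apply: eq_from_tnth => k; rewrite tnth_mktuple perm1. Qed.

Lemma perm_eq_permt n (s : 'S_n) (i : n.-tuple 'I_d) : perm_eq (permt s i) i.
Proof. by apply/tuple_permP; exists s. Qed.

Lemma is_sym_perm_eq n (q : Ten R d n) (i j : n.-tuple 'I_d) :
  is_sym q -> perm_eq i j -> q i = q j.
Proof.
move=> symq /tuple_permP[s ij]; rewrite -(symq s j); congr (q _).
exact: val_inj.
Qed.

Lemma symT_is_sym n (q : Ten R d n) : is_sym (symT q).
Proof.
move=> s i; rewrite !ffunE; congr (_ * _).
rewrite [RHS](reindex_inj (mulIg s)) /=.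
by apply: eq_bigr => t _; rewrite permt_comp.
Qed.

Lemma symT_id n (q : Ten R d n) : is_sym q -> symT q = q.
Proof.
move=> symq; apply/ffunP => i; rewrite ffunE.
under eq_bigr do rewrite symq.
rewrite sumr_const card_Sn -[X in _ * X]mulr_natl mulrA.
by rewrite mulVf ?mul1r// pnatr_eq0 -lt0n fact_gt0.
Qed.

Lemma symT_idem n (q : Ten R d n) : symT (symT q) = symT q.
Proof. exact/symT_id/symT_is_sym. Qed.

Lemma symTD n (p q : Ten R d n) : symT (p + q) = symT p + symT q.
Proof.
apply/ffunP => i; rewrite !ffunE -mulrDr -big_split/=; congr (_ * _).
by apply: eq_bigr => s _; rewrite ffunE.
Qed.

Lemma symTZ n (x : R) (q : Ten R d n) : symT (x *: q) = x *: symT q.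
Proof.
apply/ffunP => i; rewrite !ffunE scalerAr scaler_sumr; congr (_ * _).
by apply: eq_bigr => s _; rewrite ffunE.
Qed.

Lemma symTB n (p q : Ten R d n) : symT (p - q) = symT p - symT q.
Proof. by rewrite -scaleN1r symTD symTZ scaleN1r. Qed.

Lemma symT_permt n (q : Ten R d n) (s : 'S_n) :
  symT [ffun i => q (permt s i)] = symT q.
Proof.
apply/ffunP => i; rewrite !ffunE; congr (_ * _).
rewrite [RHS](reindex_inj (mulgI s)) /=.
by apply: eq_bigr => t _; rewrite ffunE permt_comp.
Qed.

(** Rearranging the indices does not change a symmetrization, and averaging
    equal tensors does nothing: this is what lets an outer symmetrization absorb
    an inner one. *)
Lemma symT_average n k (q p : Ten R d n) (f : 'S_k -> 'S_n) :
    (forall i, p i = (k`!%:R)^-1 * \sum_s q (permt (f s) i)) ->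
  symT p = symT q.
Proof.
move=> pE.
have -> : p = (k`!%:R)^-1 *: \sum_s ([ffun i => q (permt (f s) i)] : Ten R d n).
  apply/ffunP => i; rewrite pE ffunE sum_ffunE; congr (_ * _).
  by apply: eq_bigr => s _; rewrite ffunE.
rewrite symTZ (big_morph _ (@symTD n) (symT_id _)); last by move=> s i; rewrite !ffunE.
under eq_bigr do rewrite symT_permt.
rewrite sumr_const card_Sn -[X in _ *: X]scaler_nat scalerA.
by rewrite mulVf ?scale1r// pnatr_eq0 -lt0n fact_gt0.
Qed.

Lemma otimesZl m n (x : R) (p : Ten R d m) (q : Ten R d n) :
  otimes (x *: p) q = x *: otimes p q.
Proof. by apply/ffunP => i; rewrite !ffunE scalerAl. Qed.

Lemma otimesZr m n (x : R) (p : Ten R d m) (q : Ten R d n) :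
  otimes p (x *: q) = x *: otimes p q.
Proof. by apply/ffunP => i; rewrite !ffunE scalerAr. Qed.

Lemma castTZ m n (e : m = n) (x : R) (p : Ten R d m) :
  castT e (x *: p) = x *: castT e p.
Proof. by apply/ffunP => i; rewrite !ffunE. Qed.

Lemma symT_castT m n (e : m = n) (p : Ten R d m) :
  symT (castT e p) = castT e (symT p).
Proof.
case: _ / e; apply/ffunP => i; rewrite !ffunE; congr (_ * _).
by apply: eq_bigr => s _; rewrite ffunE.
Qed.

(** The direct sum of two permutations, acting on the two blocks of positions
    of a tensor product. *)
Definition sum_perm_fun m n (s : 'S_m) (t : 'S_n) (k : 'I_(m + n)) : 'I_(m + n) :=
  match fintype.split k with inl x => lshift n (s x) | inr x => rshift m (t x) end.

Lemma sum_perm_fun_inj m n (s : 'S_m) (t : 'S_n) : injective (sum_perm_fun s t).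
Proof.
apply: (can_inj (g := sum_perm_fun s^-1%g t^-1%g)) => k.
rewrite /sum_perm_fun; case: (split_ordP k) => x ->.
  by rewrite (unsplitK (inl _)) permK.
by rewrite (unsplitK (inr _)) permK.
Qed.

Definition sum_perm m n (s : 'S_m) (t : 'S_n) : 'S_(m + n) :=
  perm (@sum_perm_fun_inj m n s t).

Lemma otimes_permt m n (p : Ten R d m) (q : Ten R d n) (s : 'S_m) (t : 'S_n) i :
  otimes p q (permt (sum_perm s t) i) =
  p (permt s [tuple tnth i (lshift n k) | k < m]) *
  q (permt t [tuple tnth i (rshift m k) | k < n]).
Proof.
rewrite ffunE; congr (p _ * q _); apply: eq_from_tnth => k.
  by rewrite !tnth_mktuple permE /sum_perm_fun (unsplitK (inl _)).
by rewrite !tnth_mktuple permE /sum_perm_fun (unsplitK (inr _)).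
Qed.

Lemma symT_otimesl m n (p : Ten R d m) (q : Ten R d n) :
  symT (otimes (symT p) q) = symT (otimes p q).
Proof.
apply: (@symT_average _ m _ _ (fun s => sum_perm s 1%g)) => i.
under eq_bigr do rewrite otimes_permt permt1.
by rewrite !ffunE -mulr_suml mulrA.
Qed.

Lemma symT_otimesr m n (p : Ten R d m) (q : Ten R d n) :
  symT (otimes p (symT q)) = symT (otimes p q).
Proof.
apply: (@symT_average _ n _ _ (fun s => sum_perm 1%g s)) => i.
under eq_bigr do rewrite otimes_permt permt1.
by rewrite !ffunE -mulr_sumr mulrCA.
Qed.

Lemma val_tuple_lshift (T : Type) m n (i : (m + n).-tuple T) :
  [tuple tnth i (lshift n k) | k < m] = take m i :> seq T.
Proof.
case: m i => [|m] i; first by rewrite take0 [X in val X]tuple0.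
have x0 : T := thead i.
apply: (@eq_from_nth _ x0) => [|k]; rewrite size_tuple.
  by rewrite size_takel// size_tuple leq_addr.
move=> km; rewrite nth_take// -[k]/(val (Ordinal km)) -tnth_nth tnth_mktuple.
by rewrite (tnth_nth x0).
Qed.

Lemma val_tuple_rshift (T : Type) m n (i : (m + n).-tuple T) :
  [tuple tnth i (rshift m k) | k < n] = drop m i :> seq T.
Proof.
case: n i => [|n] i.
  by rewrite drop_oversize ?size_tuple ?addn0// [X in val X]tuple0.
have x0 : T := tnth i (rshift m ord0).
apply: (@eq_from_nth _ x0) => [|k]; rewrite size_tuple.
  by rewrite size_drop size_tuple addKn.
move=> kn; rewrite nth_drop -[k]/(val (Ordinal kn)) -tnth_nth tnth_mktuple.
by rewrite (tnth_nth x0).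
Qed.

(** Splitting a multi-index through its underlying sequence avoids all casts
    between tuple types. *)
Lemma otimesE m n (p : Ten R d m) (q : Ten R d n) (i : (m + n).-tuple 'I_d)
    (j : m.-tuple 'I_d) (k : n.-tuple 'I_d) :
  val i = val j ++ val k -> otimes p q i = p j * q k.
Proof.
move=> ijk; rewrite ffunE; congr (p _ * q _); apply: val_inj => /=.
  by rewrite [LHS]val_tuple_lshift ijk take_size_cat ?size_tuple.
by rewrite [LHS]val_tuple_rshift ijk drop_size_cat ?size_tuple.
Qed.

(** In this form a power no longer remembers on which side the factors were
    added one by one. *)
Lemma tenpowE (q : Ten R d 2) x0 n (i : (n * 2).-tuple 'I_d) :
  tenpow q n i = \prod_(k < n) q [tuple nth x0 i (k * 2); nth x0 i (k * 2).+1].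
Proof.
elim: n i => [|n IHn] i; first by rewrite ffunE big_ord0.
rewrite ffunE big_ord_recl; congr (_ * _).
  congr (q _); apply: eq_from_tnth => k; rewrite tnth_mktuple (tnth_nth x0).
  by case: k => -[|[|]].
rewrite IHn; apply: eq_bigr => k _; congr (q _); apply/val_inj => /=.
by rewrite !(val_tuple_rshift (i : (2 + n * 2).-tuple _)) !nth_drop.
Qed.

Lemma tenpowSr (q : Ten R d 2) n :
  castT (ba_order n) (otimes (tenpow q n) q) = tenpow q n.+1.
Proof.
apply/ffunP => i; have x0 : 'I_d := thead i.
rewrite (tenpowE q x0 (n := n.+1)) big_ord_recr /= ffunE ffunE (tenpowE q x0).
congr (_ * _).
  apply: eq_bigr => k _; congr (q _); apply/val_inj => /=.
  have k2 : (k * 2 + 1 < n * 2)%N.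
    by rewrite addn1 !muln2 -doubleS; case: k => k /= kn; rewrite ltn_Sdouble.
  rewrite !(val_tuple_lshift (tcast (esym (ba_order n)) i)) !val_tcast.
  by rewrite !nth_take// ?(leq_trans _ k2)// addn1.
congr (q _); apply/val_inj => /=; rewrite (val_tuple_rshift (tcast (esym (ba_order n)) i)).
have n2 : (n.+1 * 2 - n * 2)%N = 2%N by rewrite -(ba_order n) addKn.
rewrite val_tcast; apply: (@eq_from_nth _ x0); rewrite size_drop size_tuple n2//.
by case=> [|[|]]//= _; rewrite nth_drop ?addn0 ?addn1.
Qed.

Lemma symT_tenpow_left (q : Ten R d 2) n :
  symT (castT (ba_order n) (otimes (symT (tenpow q n)) q)) =
  symT (tenpow q n.+1).
Proof. by rewrite symT_castT symT_otimesl -symT_castT tenpowSr. Qed.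

Lemma symT_tenpow_right (q : Ten R d 2) n :
  symT (otimes q (symT (tenpow q n))) = symT (tenpow q n.+1).
Proof. exact: symT_otimesr. Qed.

Lemma perm_cat2 n (i j : n.-tuple 'I_d) : perm_eq (cat2 i j) (cat2 j i).
Proof. by rewrite !val_tcast /= perm_catC. Qed.

Lemma is_sym_major n (q : Ten R d (n * 2)) : is_sym q -> major_sym q.
Proof. by move=> symq i j; apply: is_sym_perm_eq => //; exact: perm_cat2. Qed.

End tensor_symmetrization.

(** * Hermite coefficients and Gaussian moments *)

Section hermite.
Local Open Scope nat_scope.

(** [hermite_coef k l] is the coefficient of the Hermite polynomial [He_l] in
    [X^k]; the recursion is [X He_l = He_(l+1) + l He_(l-1)]. *)
Fixpoint hermite_coef (k l : nat) : nat :=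
  if k is k'.+1 then
    (if l is l'.+1 then hermite_coef k' l' else 0) + l.+1 * hermite_coef k' l.+1
  else (l == 0).

(** The constant Hermite coefficient of [X^k] is the expectation of [X^k], since
    [He_l] has mean zero for [l > 0]. *)
Definition gauss_moment k := hermite_coef k 0.

Lemma hermite_coef_gt k l : k < l -> hermite_coef k l = 0.
Proof.
elim: k l => [|k IHk] [|l]//=; rewrite ltnS => kl.
by rewrite !IHk ?muln0// ltnW// ltnW.
Qed.

Lemma hermite_coefkk k : hermite_coef k k = 1.
Proof. by elim: k => //= k ->; rewrite hermite_coef_gt ?muln0. Qed.

Lemma hermite_coefSS k l :
  hermite_coef k.+1 l.+1 = hermite_coef k l + l.+2 * hermite_coef k l.+2.
Proof. by []. Qed.

Lemma hermite_coefS0 k : hermite_coef k.+1 0 = hermite_coef k 1.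
Proof. by rewrite /= add0n mul1n. Qed.

(** Compare the derivatives of both sides of [X^(k+1) = sum_l h(k+1,l) He_l],
    using [He_(l+1)' = (l+1) He_l]. *)
Lemma hermite_coef_deriv k l :
  l.+1 * hermite_coef k.+1 l.+1 = k.+1 * hermite_coef k l.
Proof.
elim: k l => [|k IHk] l; [by case: l => [|l] //=; rewrite !muln0|].
rewrite hermite_coefSS IHk; case: l => [|l]; first by rewrite hermite_coefS0 mul1n -mulSn.
have := IHk l; rewrite hermite_coefSS; move: (hermite_coef k _) => A.
move: (hermite_coef k _) => B; nia.
Qed.

Lemma gauss_momentSS k : gauss_moment k.+2 = k.+1 * gauss_moment k.
Proof. by rewrite /gauss_moment hermite_coefS0 -hermite_coef_deriv mul1n. Qed.

(** Multiplication by [X] is a symmetric operator for the scalar product in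
    which the [He_l] are orthogonal with squared norms [l!]: the right-hand side
    is symmetric in [j] and [k]. *)
Lemma hermite_pairing_step N j k : j <= N ->
  \sum_(l < N.+1) l`! * hermite_coef j.+1 l * hermite_coef k l =
  \sum_(l < N) l.+1`! * hermite_coef j l * hermite_coef k l.+1 +
  \sum_(l < N) l.+1`! * hermite_coef k l * hermite_coef j l.+1.
Proof.
move=> jN.
transitivity (\sum_(l < N.+1) l`! *
    (if val l is l'.+1 then hermite_coef j l' else 0) * hermite_coef k l +
  \sum_(l < N.+1) l.+1`! * hermite_coef k l * hermite_coef j l.+1).
  rewrite -big_split /=; apply: eq_bigr => -[[|l] lN] _ /=.
    by rewrite factS fact0 muln0 mul0n !mul1n !add0n mulnC.
  by rewrite [l.+2`!]factS; ring.
congr (_ + _); first by rewrite big_ord_recl /= muln0 mul0n add0n.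
by rewrite big_ord_recr /= (@hermite_coef_gt j)// muln0 addn0.
Qed.

(** The scalar product of [X^j] and [X^k] only depends on [j + k], because
    factors [X] can be moved from one side to the other one at a time. *)
Lemma gauss_momentD N j k : j + k < N ->
  gauss_moment (j + k) = \sum_(l < N) l`! * hermite_coef j l * hermite_coef k l.
Proof.
case: N => // N; rewrite ltnS.
elim: j k => [|j IHj] k jkN.
  by rewrite big_ord_recl big1 ?addn0 /= ?mul1n// => l _; rewrite muln0.
rewrite addSnnS IHj; last by rewrite -addSnnS.
rewrite hermite_pairing_step; last by lia.
rewrite addnC -hermite_pairing_step; last by lia.
by apply: eq_bigr => l _; rewrite -!mulnA [X in _ * X]mulnC.
Qed.

End hermite.

(** * Symmetrized powers of the identity tensor *)

Section wick.
Context {R : realType} {e : nat}.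

Definition kron : Ten R e 2 :=
  [ffun i => (tnth i ord0 == tnth i (lift ord0 ord0))%:R].

(** The moments [E (X_(w 1) ... X_(w n))] of a standard Gaussian vector. *)
Definition moment_ten n : Ten R e n :=
  [ffun w : n.-tuple 'I_e => (\prod_x gauss_moment (count_mem x w))%:R].

Lemma thead_tail n (v : n.+2.-tuple 'I_e) :
  thead (tail v) = tnth v (lift ord0 ord0).
Proof.
by have x0 : 'I_e := tnth v ord0; rewrite /thead !(tnth_nth x0) /= nth_behead.
Qed.

(** A nonzero term of the symmetrization starts with two equal indices [x].
    Removing them lowers one multiplicity by two, and the recursion
    [m(k+2) = (k+1) m(k)] of the Gaussian moments expresses the remaining
    moment through the moment of [w] itself. *)
Lemma otimes_kron_moment n (w v : n.+2.-tuple 'I_e) : perm_eq v w ->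
  let x := thead v in let y := thead (tail v) in
  otimes kron (moment_ten n) v =
  moment_ten n.+2 w * ((x == y)%:R / (count_mem x w).-1%:R).
Proof.
case/tupleP: v => x v; case/tupleP: v => y v xyvw /=.
rewrite theadE [thead (tail _)](_ : _ = y); last by rewrite /thead !(tnth_nth x).
rewrite (@otimesE _ _ _ _ _ _ _ [tuple x; y] v)// ffunE /= (tnth_nth x) /=.
case: (eqVneq x y) xyvw => [<-|xy] xyvw; last by rewrite !mul0r mulr0.
rewrite mul1r !ffunE /= (bigD1 x)//= [in RHS](bigD1 x)//=.
have /seq.permP cw := xyvw; rewrite -!cw /= eqxx !add1n -pred_Sn gauss_momentSS.
rewrite [in RHS](eq_bigr (fun z => gauss_moment (count_mem z v))); last first.
  by move=> z zx; rewrite -cw /= [x == z]eq_sym (negbTE zx).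
by rewrite -mulnA [in RHS]natrM mul1r [RHS]mulrAC divff ?mul1r// pnatr_eq0.
Qed.

(** For a random permutation [s], given [s 0] the value [s 1] is uniform among
    the other positions. *)
Lemma sum_perm_pair n (G : 'I_n.+2 -> 'I_n.+2 -> R) :
  n.+1%:R * (\sum_(s : 'S_n.+2) G (s ord0) (s (lift ord0 ord0))) =
  \sum_(s : 'S_n.+2) \sum_(q | q != s ord0) G (s ord0) q.
Proof.
have reindex_s (q : 'I_n.+2) : q != ord0 ->
    \sum_(s : 'S_n.+2) G (s ord0) (s (lift ord0 ord0)) =
    \sum_(s : 'S_n.+2) G (s ord0) (s q).
  move=> q0; rewrite (reindex_inj (mulgI (tperm (lift ord0 ord0) q))) /=.
  by apply: eq_bigr => s _; rewrite !permM tpermL tpermD// eq_sym.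
transitivity (\sum_(q : 'I_n.+2 | q != ord0)
    \sum_(s : 'S_n.+2) G (s ord0) (s (lift ord0 ord0))).
  by rewrite sumr_const cardC1 card_ord mulr_natl.
rewrite (eq_bigr _ reindex_s) exchange_big; apply: eq_bigr => s _.
rewrite [RHS](reindex_inj (@perm_inj _ s)) /=.
by apply: eq_bigl => q; rewrite (inj_eq (@perm_inj _ s)).
Qed.

Lemma sum_tnth_eq n (w : n.-tuple 'I_e) p :
  \sum_(q | q != p) (tnth w p == tnth w q)%:R = (count_mem (tnth w p) w).-1%:R :> R.
Proof.
rewrite -natr_sum; congr (_%:R).
have : (\sum_q (tnth w q == tnth w p) = count_mem (tnth w p) w)%N.
  by rewrite -sum1_count big_tuple [RHS]big_mkcond; apply: eq_bigr => q _ /=; case: eqP.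
rewrite (bigD1 p)//= eqxx add1n => <-.
by rewrite -pred_Sn; apply: eq_bigr => q _; rewrite eq_sym.
Qed.

(** By [otimes_kron_moment] every term of the symmetrization is the moment of [w]
    times a weight: the indicator that the first two indices agree, divided by
    the number of other positions that carry the same index as the first one.
    The average of this weight over all permutations is [1 / (n + 1)]. *)
Lemma symT_kron_moment n :
  symT (otimes kron (moment_ten n)) = n.+1%:R^-1 *: moment_ten n.+2.
Proof.
apply/ffunP => w; rewrite ffunE [RHS]ffunE.
pose G p q : R := (tnth w p == tnth w q)%:R / (count_mem (tnth w p) w).-1%:R.
rewrite (eq_bigr (fun s : 'S_n.+2 =>
  moment_ten n.+2 w * G (s ord0) (s (lift ord0 ord0)))); last first.
  move=> s _; rewrite (otimes_kron_moment (perm_eq_permt s w)); congr (_ * _).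
  by rewrite thead_tail /thead !tnth_mktuple.
rewrite -mulr_sumr mulrCA.
have [U0|UN0] := eqVneq (moment_ten n.+2 w) 0; first by rewrite U0 !mul0r scaler0.
(* An index of multiplicity one would make the weight [0 / 0]; then the moment
   vanishes, as first moments do. *)
have c1 x : count_mem x w != 1%N.
  apply: contra UN0 => /eqP c1; rewrite ffunE pnatr_eq0 -leqn0.
  by rewrite (bigD1 x)//= c1 mul0n.
have nfact : (n.+2)`!%:R != 0 :> R by rewrite pnatr_eq0 -lt0n fact_gt0.
have n1 : n.+1%:R != 0 :> R by rewrite pnatr_eq0.
suff -> : \sum_(s : 'S_n.+2) G (s ord0) (s (lift ord0 ord0)) =
    n.+1%:R^-1 * (n.+2)`!%:R.
  by rewrite [X in _ * X]mulrCA mulVf// mulr1 mulrC.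
apply: (mulfI n1); rewrite mulVKf// sum_perm_pair.
rewrite (eq_bigr (fun=> 1)) => [|s _].
  by rewrite sumr_const card_Sn.
rewrite /G -mulr_suml sum_tnth_eq divff// pnatr_eq0.
have : (0 < count_mem (tnth w (s ord0)) w)%N by rewrite -has_count has_pred1 mem_tnth.
by case: (count_mem _ w) (c1 (tnth w (s ord0))) => [|[|]].
Qed.

(** This is [1 / (2n - 1)!!], one over the number of pairings of [2n] points. *)
Fixpoint wick_const n : R := if n is n'.+1 then wick_const n' / (n' * 2).+1%:R else 1.

Lemma wick_const_gt0 n : 0 < wick_const n.
Proof. by elim: n => //= n IHn; rewrite divr_gt0. Qed.

(** Wick's formula: Gaussian moments are averages over pairings. *)
Lemma symT_tenpow_kron n :
  symT (tenpow kron n) = wick_const n *: moment_ten (n * 2).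
Proof.
elim: n => [|n IHn].
  rewrite scale1r symT_id => [|s i]; last by rewrite !ffunE.
  apply/ffunP => i; rewrite !ffunE big1// => x _.
  by rewrite (tuple0 i).
rewrite -symT_tenpow_right IHn otimesZr symTZ symT_kron_moment scalerA.
by rewrite (_ : wick_const n.+1 = wick_const n * (n * 2).+1%:R^-1).
Qed.

End wick.

(** * The quadratic form of the Gaussian moment tensor *)

Section quadratic_forms.
Context {R : realType}.

Definition quad_form d n (q : Ten R d (n * 2)) (xi : Ten R d n) : R :=
  \sum_i \sum_j q (cat2 i j) * xi i * xi j.

(** View [xi] as the homogeneous polynomial with coefficients [xi w]: this is its
    coefficient along the product over [x] of the Hermite polynomials of degree
    [f x] in the [x]-th variable. *)
Definition hermite_coord e n (xi : Ten R e n) (f : {ffun 'I_e -> 'I_(n * 2).+1}) : R :=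
  \sum_w xi w * (\prod_x hermite_coef (count_mem x w) (f x))%:R.

Lemma moment_ten_cat2 e n (i j : n.-tuple 'I_e) :
  moment_ten (n * 2) (cat2 i j) =
  \sum_(f : {ffun 'I_e -> 'I_(n * 2).+1}) (\prod_x (f x)`!)%:R *
    ((\prod_x hermite_coef (count_mem x i) (f x))%:R *
     (\prod_x hermite_coef (count_mem x j) (f x))%:R) :> R.
Proof.
rewrite ffunE (eq_bigr (fun x => (\sum_(l < (n * 2).+1)
  l`! * hermite_coef (count_mem x i) l * hermite_coef (count_mem x j) l)%N)).
  rewrite bigA_distr_bigA natr_sum; apply: eq_bigr => f _.
  by rewrite -!natrM -!big_split /=; congr (_%:R); apply: eq_bigr => x _; rewrite mulnA.
move=> x _; rewrite val_tcast /= count_cat (@gauss_momentD (n * 2).+1)// ltnS muln2 -addnn.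
by rewrite leq_add// (leq_trans (count_size _ _))// size_tuple.
Qed.

(** The form is the Gaussian expectation of the square of the polynomial of
    [xi]; this is Parseval's identity in the Hermite basis. *)
Lemma quad_form_moment e n (xi : Ten R e n) :
  quad_form (moment_ten (n * 2)) xi =
  \sum_(f : {ffun 'I_e -> 'I_(n * 2).+1}) (\prod_x (f x)`!)%:R *
    hermite_coord xi f ^+ 2.
Proof.
rewrite /quad_form; under eq_bigr do under eq_bigr do rewrite moment_ten_cat2 -mulrA mulr_suml.
under eq_bigr do rewrite exchange_big; rewrite exchange_big; apply: eq_bigr => f _.
rewrite expr2 /hermite_coord mulr_suml mulr_sumr; apply: eq_bigr => i _ /=.
rewrite !mulr_sumr; apply: eq_bigr => j _.
by rewrite -!mulrA; congr (_ * _); ring.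
Qed.

Lemma quad_form_moment_ge0 e n (xi : Ten R e n) :
  0 <= quad_form (moment_ten (n * 2)) xi.
Proof.
by rewrite quad_form_moment sumr_ge0// => f _; rewrite mulr_ge0// sqr_ge0.
Qed.

Lemma sum_count_mem (T : finType) (s : seq T) : (\sum_x count_mem x s)%N = size s.
Proof.
elim: s => [|y s IHs] /=; first by rewrite big1.
rewrite big_split /= IHs -add1n; congr (_ + _)%N.
by rewrite (bigD1 y)//= eqxx big1 ?addn0// => x; rewrite eq_sym => /negbTE ->.
Qed.

Lemma count_mem_dominated (T : finType) (s t : seq T) : size s = size t ->
  (forall x, (count_mem x s <= count_mem x t)%N) -> perm_eq s t.
Proof.
move=> st le_st; rewrite /perm_eq; apply/allP => x _ /=; move: x.
have [_] := leqif_sum (fun x (_ : true) => leqif_eq (le_st x)).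
by rewrite !sum_count_mem st eqxx => /esym/forallP.
Qed.

Definition count_index e n (w : n.-tuple 'I_e) : {ffun 'I_e -> 'I_(n * 2).+1} :=
  [ffun x => inord (count_mem x w)].

Lemma count_indexE e n (w : n.-tuple 'I_e) x :
  count_index w x = count_mem x w :> nat.
Proof.
rewrite ffunE inordK// ltnS muln2 -addnn (leq_trans (count_size _ _))//.
by rewrite size_tuple leq_addr.
Qed.

(** A monomial of degree [n] has a component along the Hermite product of
    multidegree [count_index w0], also of degree [n], only if it is the monomial
    of [w0]. *)
Lemma hermite_coord_top e n (xi : Ten R e n) (w0 : n.-tuple 'I_e) : is_sym xi ->
  hermite_coord xi (count_index w0) = xi w0 *+ #|[pred w : n.-tuple 'I_e | perm_eq w w0]|.
Proof.
move=> symxi; rewrite /hermite_coord -sumr_const big_mkcond [RHS]big_mkcond /=.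
apply: eq_bigr => w _; rewrite inE; case: ifPn => [ww0|nww0].
  rewrite (is_sym_perm_eq symxi ww0) big1 ?mulr1// => x _.
  by rewrite count_indexE; have /seq.permP -> := ww0; rewrite hermite_coefkk.
have /existsP[x xw] : [exists x, (count_mem x w < count_mem x w0)%N].
  apply: contraNT nww0; rewrite negb_exists => /forallP le_w.
  rewrite perm_sym; apply: count_mem_dominated => [|x]; first by rewrite !size_tuple.
  by rewrite leqNgt le_w.
by rewrite (bigD1 x)//= count_indexE hermite_coef_gt// mul0n mulr0.
Qed.

Lemma quad_form_moment_eq0 e n (xi : Ten R e n) : is_sym xi ->
  quad_form (moment_ten (n * 2)) xi = 0 -> xi = 0.
Proof.
move=> symxi /eqP; rewrite quad_form_moment psumr_eq0 => [/allP xi0|f _]; last first.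
  by rewrite mulr_ge0// sqr_ge0.
apply/ffunP => w0; rewrite ffunE.
have := xi0 (count_index w0) (mem_index_enum _).
rewrite /= mulf_eq0 sqrf_eq0 pnatr_eq0 eqn0Ngt prodn_cond_gt0 /= => [|x _]; last exact: fact_gt0.
rewrite hermite_coord_top// mulrn_eq0 => /orP[]; last by move/eqP.
by move/eqP/card0_eq/(_ w0); rewrite inE perm_refl.
Qed.

End quadratic_forms.

(** * Linear changes of variables in tensors *)

Section change_of_basis.
Context {R : realType}.

Definition mx_coef e d (B : 'M[R]_(e, d)) (v : seq 'I_e) (w : seq 'I_d) : R :=
  \prod_(p <- zip v w) B p.1 p.2.

Definition mxten e d (B : 'M[R]_(e, d)) n (T : Ten R e n) : Ten R d n :=
  [ffun w : n.-tuple 'I_d => \sum_v T v * mx_coef B v w].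

Lemma mx_coefE e d (B : 'M[R]_(e, d)) n (v : n.-tuple 'I_e) (w : n.-tuple 'I_d) :
  mx_coef B v w = \prod_k B (tnth v k) (tnth w k).
Proof.
elim: n v w => [|n IHn] v w; first by rewrite (tuple0 v) (tuple0 w) /mx_coef big_nil big_ord0.
case/tupleP: v => i v; case/tupleP: w => j w.
rewrite /mx_coef big_cons big_ord_recl !tnth0; congr (_ * _).
by rewrite [LHS]IHn; apply: eq_bigr => k _; rewrite !tnthS.
Qed.

Lemma mx_coef_cat e d (B : 'M[R]_(e, d)) v1 v2 w1 w2 : size v1 = size w1 ->
  mx_coef B (v1 ++ v2) (w1 ++ w2) = mx_coef B v1 w1 * mx_coef B v2 w2.
Proof. by move=> vw; rewrite /mx_coef zip_cat// big_cat. Qed.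

Lemma mx_coef_permt e d (B : 'M[R]_(e, d)) n (s : 'S_n) v w :
  mx_coef B (permt s v) (permt s w) = mx_coef B v w.
Proof.
rewrite !mx_coefE [RHS](reindex_inj (@perm_inj _ s)) /=.
by apply: eq_bigr => k _; rewrite !tnth_mktuple.
Qed.

Lemma mx_coef_tr e d (B : 'M[R]_(e, d)) n (v : n.-tuple 'I_e) (w : n.-tuple 'I_d) :
  mx_coef B^T w v = mx_coef B v w.
Proof. by rewrite !mx_coefE; apply: eq_bigr => k _; rewrite mxE. Qed.

Lemma mxten_symT e d (B : 'M[R]_(e, d)) n (T : Ten R e n) :
  mxten B (symT T) = symT (mxten B T).
Proof.
apply/ffunP => w; rewrite !ffunE.
under eq_bigr do rewrite ffunE -mulrA mulr_suml.
rewrite -mulr_sumr exchange_big; congr (_ * _); apply: eq_bigr => s _ /=.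
rewrite ffunE [RHS](reindex_inj (h := permt s)) /=.
  by apply: eq_bigr => v _; rewrite mx_coef_permt.
by apply: (can_inj (g := permt s^-1%g)) => v; rewrite permt_comp mulVg permt1.
Qed.

Lemma mxten_is_sym e d (B : 'M[R]_(e, d)) n (T : Ten R e n) :
  is_sym T -> is_sym (mxten B T).
Proof. by move=> symT_T; rewrite -(symT_id symT_T) mxten_symT; exact: symT_is_sym. Qed.

Lemma sum_tuple_cat e m n k (mn : (m + n)%N = k) (F : k.-tuple 'I_e -> R) :
  \sum_v F v =
  \sum_(i : m.-tuple 'I_e) \sum_(j : n.-tuple 'I_e) F (tcast mn [tuple of i ++ j]).
Proof.
case: k / mn F => F; rewrite pair_big /=.
pose split_tuple (v : (m + n).-tuple 'I_e) :=
  ([tuple tnth v (lshift n k) | k < m], [tuple tnth v (rshift m k) | k < n]).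
rewrite (reindex (fun p : m.-tuple 'I_e * n.-tuple 'I_e => [tuple of p.1 ++ p.2])) //=.
exists split_tuple => [[i j] _|v _].
  congr pair; apply: eq_from_tnth => x; rewrite tnth_mktuple.
    by rewrite tnth_lshift.
  by rewrite tnth_rshift.
apply: val_inj; rewrite /= [X in X ++ _]val_tuple_lshift.
by rewrite [X in _ ++ X]val_tuple_rshift cat_take_drop.
Qed.

Lemma mxten_otimes e d (B : 'M[R]_(e, d)) m n (p : Ten R e m) (q : Ten R e n) :
  mxten B (otimes p q) = otimes (mxten B p) (mxten B q).
Proof.
apply/ffunP => w; rewrite !ffunE (sum_tuple_cat (erefl (m + n)%N)) mulr_suml.
apply: eq_bigr => i _; rewrite mulr_sumr; apply: eq_bigr => j _.
rewrite tcast_id (@otimesE _ _ _ _ _ _ _ i j)// /=.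
rewrite -[in LHS](cat_take_drop m w) mx_coef_cat; last first.
  by rewrite size_takel size_tuple// leq_addr.
by rewrite -val_tuple_lshift -val_tuple_rshift mulrACA.
Qed.

Lemma mxten_tenpow e d (B : 'M[R]_(e, d)) (q : Ten R e 2) n :
  mxten B (tenpow q n) = tenpow (mxten B q) n.
Proof.
elim: n => [|n IHn]; last first.
  by rewrite [RHS]/= -IHn; exact: (mxten_otimes B q (tenpow q n)).
apply/ffunP => w; rewrite !ffunE (big_pred1 [tuple]) => [|v]; last first.
  by apply/esym/eqP/val_inj; case: v => -[].
by rewrite ffunE mul1r mx_coefE big_ord0.
Qed.

(** Distributivity, with the functions indexing the expanded product encoded as
    tuples. *)
Lemma sum_tuple_prod e n (F : 'I_n -> 'I_e -> R) :
  \sum_(v : n.-tuple 'I_e) \prod_k F k (tnth v k) = \prod_k \sum_m F k m.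
Proof.
rewrite bigA_distr_bigA (reindex (@finfun_of_tuple _ _)) /=; last first.
  by exists (@tuple_of_finfun _ _) => f _; rewrite ?finfun_of_tupleK ?tuple_of_finfunK.
by apply: eq_bigr => v _; apply: eq_bigr => k _; rewrite ffunE.
Qed.

Lemma mxtenM d1 d2 d3 (B : 'M[R]_(d1, d2)) (C : 'M[R]_(d2, d3)) n (T : Ten R d1 n) :
  mxten C (mxten B T) = mxten (B *m C) T.
Proof.
apply/ffunP => w; rewrite !ffunE.
under eq_bigr do rewrite ffunE mulr_suml.
rewrite exchange_big; apply: eq_bigr => u _ /=.
under eq_bigr do rewrite -mulrA.
rewrite -mulr_sumr mx_coefE; congr (_ * _).
rewrite (eq_bigr (fun v : n.-tuple 'I_d2 =>
  \prod_k (B (tnth u k) (tnth v k) * C (tnth v k) (tnth w k)))) => [|v _]; last first.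
  by rewrite !mx_coefE -big_split.
rewrite (sum_tuple_prod (fun k m => B (tnth u k) m * C m (tnth w k))).
by apply: eq_bigr => k _; rewrite mxE.
Qed.

Lemma mxten1 d n (T : Ten R d n) : mxten 1%:M T = T.
Proof.
apply/ffunP => w; rewrite ffunE (bigD1 w)//= mx_coefE big1 => [|k _]; last first.
  by rewrite mxE eqxx.
rewrite mulr1 big1 ?addr0// => v vw; rewrite mx_coefE.
have /existsP[k vwk] : [exists k, tnth v k != tnth w k].
  apply: contraNT vw; rewrite negb_exists => /forallP eqvw.
  by apply/eqP/eq_from_tnth => k; apply/eqP; rewrite -[_ == _]negbK.
by rewrite (bigD1 k)//= mxE (negbTE vwk) mul0r mulr0.
Qed.

Lemma quad_form_mxten e d (B : 'M[R]_(e, d)) n (q : Ten R e (n * 2)) (xi : Ten R d n) :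
  quad_form (mxten B q) xi = quad_form q (mxten B^T xi).
Proof.
rewrite /quad_form.
transitivity (\sum_(i : n.-tuple 'I_d) \sum_(j : n.-tuple 'I_d)
    \sum_(u : n.-tuple 'I_e) \sum_(v : n.-tuple 'I_e)
    q (cat2 u v) * (xi i * mx_coef B u i) * (xi j * mx_coef B v j)).
  apply: eq_bigr => i _; apply: eq_bigr => j _; rewrite ffunE.
  rewrite (sum_tuple_cat (etrans (addnn n) (esym (muln2 n)))) !mulr_suml.
  apply: eq_bigr => u _; rewrite !mulr_suml; apply: eq_bigr => v _.
  rewrite -/(cat2 u v) !val_tcast /= mx_coef_cat ?size_tuple//; ring.
under eq_bigr do rewrite exchange_big; rewrite exchange_big; apply: eq_bigr => u _ /=.
under eq_bigr do rewrite exchange_big; rewrite exchange_big; apply: eq_bigr => v _ /=.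
rewrite !ffunE -mulrA mulr_suml mulr_sumr; apply: eq_bigr => i _.
rewrite [in RHS]mulrA mulr_sumr; apply: eq_bigr => j _.
by rewrite !mx_coef_tr.
Qed.

Lemma mxten_kron e d (B : 'M[R]_(e, d)) (i : 2.-tuple 'I_d) :
  mxten B kron i = (B^T *m B) (tnth i ord0) (tnth i (lift ord0 ord0)).
Proof.
rewrite ffunE mxE (sum_tuple_cat (erefl (1 + 1)%N)).
rewrite (reindex (fun m : 'I_e => [tuple m])) /=; last first.
  exists (@thead 0 _) => [m _|v _]; first by rewrite theadE.
  by case/tupleP: v => x v; apply: val_inj; rewrite /= theadE (tuple0 v).
apply: eq_bigr => m _; rewrite (bigD1 [tuple m])//= big1 ?addr0.
  rewrite ffunE mx_coefE big_ord_recl big_ord1 !(tnth_nth m) /= eqxx mul1r.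
  by rewrite mxE.
move=> v vm; rewrite ffunE !(tnth_nth m) /=.
have [mv|] := m =P nth m v (0 + 0); last by rewrite mul0r.
by case/eqP: vm; apply: val_inj; case/tupleP: v mv => x v /=; rewrite (tuple0 v) => ->.
Qed.

(** Reduce to the identity tensor by the invertible change of variables [B]; the
    Gaussian moment form is definite, and [B] maps no nonzero tensor to zero. *)
Lemma quad_form_tenpow_gt0 d (A : Ten R d 2) (B : 'M[R]_d) n (xi : Ten R d n) :
    B \in unitmx ->
    (forall i, A i = (B^T *m B) (tnth i ord0) (tnth i (lift ord0 ord0))) ->
    is_sym xi -> xi != 0 ->
  0 < quad_form (symT (tenpow A n)) xi.
Proof.
move=> Bu AB symxi xi0.
have -> : A = mxten B kron by apply/ffunP => i; rewrite AB mxten_kron.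
rewrite -mxten_tenpow -mxten_symT quad_form_mxten symT_tenpow_kron.
rewrite /quad_form; under eq_bigr do under eq_bigr do rewrite ffunE -2!mulrA.
under eq_bigr do rewrite -mulr_sumr; rewrite -mulr_sumr.
rewrite mulr_gt0 ?wick_const_gt0//.
under eq_bigr do under eq_bigr do rewrite mulrA.
rewrite lt_neqAle quad_form_moment_ge0 andbT eq_sym; apply: contra xi0.
move=> /eqP/(quad_form_moment_eq0 (mxten_is_sym _ symxi)) Bxi0.
rewrite -[xi](mxten1) -(mulmxV (_ : B^T \in unitmx)) ?unitmx_tr// -mxtenM Bxi0.
by apply/eqP/ffunP => w; rewrite !ffunE big1// => v _; rewrite ffunE mul0r.
Qed.

End change_of_basis.

(** * Real symmetric matrices *)

Section real_symmetric_matrices.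
Context {R : realType}.

Definition mxquad n (A : 'M[R]_n) (v : 'rV[R]_n) : R := (v *m A *m v^T) 0 0.

Definition pos_def n (A : 'M[R]_n) : Prop := forall v, v != 0 -> 0 < mxquad A v.

(** Gaussian elimination: the Schur complement of a positive definite matrix is
    the minimum of its form over the first coordinate, so it is again positive
    definite. *)
Lemma cholesky n (A : 'M[R]_n) : A^T = A -> pos_def A ->
  exists2 B : 'M[R]_n, B \in unitmx & A = B^T *m B.
Proof.
elim: n A => [|n IHn] A symA pdA.
  by exists 1%:M; rewrite ?unitmx1// [A]flatmx0 [RHS]flatmx0.
move: A symA pdA; rewrite -[n.+1]add1n => A symA pdA.
have : A^T = A by []. rewrite -[A]submxK tr_block_mx => /eq_block_mx[_ _ dlA drA].
move: pdA; rewrite -[A]submxK -dlA.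
have -> : ulsubmx A = (ulsubmx A 0 0)%:M by rewrite [LHS]mx11_scalar.
move: (ulsubmx A 0 0) (ursubmx A) (drsubmx A) drA => al u D symD pdA.
have quadE (x : R) (y : 'rV_n) : mxquad (block_mx al%:M u u^T D) (row_mx x%:M y) =
    x ^+ 2 * al + 2 * x * (u *m y^T) 0 0 + mxquad D y.
  rewrite /mxquad mul_row_block tr_row_mx mul_row_col tr_scalar_mx !mulmxDl.
  rewrite !mul_mx_scalar !mul_scalar_mx -scalemxAl.
  have -> : y *m u^T = (u *m y^T)^T by rewrite trmx_mul trmxK.
  by move: (u *m y^T) (y *m D *m y^T) => M Q; rewrite !mxE mulr1n; ring.
have al0 : 0 < al.
  have /pdA : row_mx (1%:M : 'M[R]_1) (0 : 'rV[R]_n) != 0.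
    apply/eqP; rewrite -row_mx0 => /eq_row_mx[/matrixP/(_ 0 0)]; rewrite !mxE => /eqP.
    by rewrite oner_eq0.
  rewrite quadE trmx0 mulmx0 /mxquad !mul0mx [in X in 2 * 1 * X]mxE [X in _ + X]mxE.
  by rewrite mulr0 !addr0 expr1n mul1r.
have [||C Cu DC] := IHn (D - al^-1 *: (u^T *m u)).
- by rewrite linearB linearZ /= trmx_mul trmxK symD.
- move=> y y0; set t := (u *m y^T) 0 0.
  (* the first coordinate that minimizes the form, the others being fixed *)
  have : row_mx (- (al^-1 * t))%:M y != 0.
    by apply: contra y0 => /eqP; rewrite -row_mx0 => /eq_row_mx[_ ->].
  move/pdA; rewrite quadE -/t.
  suff -> : mxquad (D - al^-1 *: (u^T *m u)) y = mxquad D y - al^-1 * t ^+ 2.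
    by congr (_ < _); field; rewrite gt_eqF.
  rewrite /mxquad mulmxBr mulmxBl -scalemxAr -scalemxAl mulmxA -[y *m _ *m _ *m _]mulmxA.
  have -> : y *m u^T = (u *m y^T)^T by rewrite trmx_mul trmxK.
  by rewrite [u *m y^T]mx11_scalar -/t tr_scalar_mx -scalar_mxM !mxE eqxx expr2.
exists (block_mx (Num.sqrt al)%:M ((Num.sqrt al)^-1 *: u) 0 C).
  rewrite unitmxE det_ublock det_scalar1 unitrM unitfE gt_eqF ?sqrtr_gt0//=.
rewrite submxK; have sal : Num.sqrt al != 0 by rewrite gt_eqF ?sqrtr_gt0.
rewrite tr_block_mx mulmx_block tr_scalar_mx trmx0 !mul0mx !mulmx0 !addr0.
rewrite -scalar_mxM -expr2 sqr_sqrtr ?ltW// mul_scalar_mx scalerA mulfV// scale1r.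
rewrite linearZ /= mul_mx_scalar scalerA mulfV// scale1r -scalemxAl -scalemxAr scalerA.
by rewrite -expr2 exprVn sqr_sqrtr ?ltW// -DC addrC subrK.
Qed.

Lemma mxquadE n (A : 'M[R]_n) v : mxquad A v = \sum_i \sum_j A i j * v 0 i * v 0 j.
Proof.
rewrite /mxquad mxE; under eq_bigr do rewrite mxE big_distrl /=.
rewrite exchange_big; apply: eq_bigr => i _; apply: eq_bigr => j _.
by rewrite mxE [v 0 i * _]mulrC.
Qed.

Lemma continuous_mxquad n (A : 'M[R]_n) : continuous (mxquad A).
Proof.
rewrite (_ : mxquad A = fun v => \sum_i \sum_j A i j * v 0 i * v 0 j); last first.
  by apply/funext => v; rewrite mxquadE.
apply: continuous_big => [|i _]; first exact: add_continuous.
apply: continuous_big => [|j _ v]; first exact: add_continuous.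
apply: (@continuousM _ _ (fun w : 'rV[R]_n => A i j * w 0 i) (fun w : 'rV[R]_n => w 0 j)).
  apply: (@continuousM _ _ (fun _ : 'rV[R]_n => A i j) (fun w : 'rV[R]_n => w 0 i)).
    exact: cst_continuous.
  exact: coord_continuous.
exact: coord_continuous.
Qed.

Lemma mxquad1 n (v : 'rV[R]_n) : mxquad 1%:M v = \sum_j v 0 j ^+ 2.
Proof. by rewrite /mxquad mulmx1 mxE; apply: eq_bigr => j _; rewrite mxE. Qed.

Lemma mxquad1_eq0 n (v : 'rV[R]_n) : (mxquad 1%:M v == 0) = (v == 0).
Proof.
rewrite mxquad1 psumr_eq0 => [|j _]; last exact: sqr_ge0.
apply/allP/eqP => [v0|-> j _]; last by rewrite /= mxE expr0n eqxx.
apply/rowP => j; rewrite mxE; apply/eqP; have := v0 j (mem_index_enum _).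
by rewrite sqrf_eq0.
Qed.

Lemma mxquad1_ge0 n (v : 'rV[R]_n) : 0 <= mxquad 1%:M v.
Proof. by rewrite mxquad1 sumr_ge0// => j _; exact: sqr_ge0. Qed.

Lemma mxquadZ n (A : 'M[R]_n) x v : mxquad A (x *: v) = x ^+ 2 * mxquad A v.
Proof. by rewrite /mxquad linearZ /= -scalemxAr -!scalemxAl !mxE mulrA expr2. Qed.

Lemma mxquadDl n (A B : 'M[R]_n) v : mxquad (A + B) v = mxquad A v + mxquad B v.
Proof. by rewrite /mxquad mulmxDr mulmxDl mxE. Qed.

Lemma mxquadN n (A : 'M[R]_n) v : mxquad (- A) v = - mxquad A v.
Proof. by rewrite /mxquad mulmxN mulNmx mxE. Qed.

Lemma mxquad_scalar n (x : R) (v : 'rV[R]_n) : mxquad x%:M v = x * mxquad 1%:M v.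
Proof. by rewrite /mxquad mul_mx_scalar mulmx1 -scalemxAl mxE. Qed.

Lemma mxquad_eigen n (A : 'M[R]_n) x v : v *m A = x *: v ->
  mxquad A v = x * mxquad 1%:M v.
Proof. by rewrite /mxquad => ->; rewrite mulmx1 -scalemxAl mxE. Qed.

Lemma compact_sphere n : compact [set v : 'rV[R]_n | mxquad 1%:M v = 1].
Proof.
apply: bounded_closed_compact.
  exists 1; split => // M M1 v /= v1; rewrite [leLHS]/Num.norm /= mx_normrE.
  apply/bigmax_leP; split => [|[i j] _ /=]; first by rewrite ltW// (lt_trans _ M1).
  rewrite (le_trans _ (ltW M1))// ord1 -(@ler_pXn2r _ 2)// ?nnegrE// expr1n.
  rewrite real_normK ?num_real// -v1 mxquad1 (bigD1 j)//= lerDl.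
  by rewrite sumr_ge0// => k _; exact: sqr_ge0.
rewrite (_ : mkset _ = mxquad 1%:M @^-1` [set x | x = 1])//.
apply: closed_comp => [v _|]; [exact: continuous_mxquad|exact: closed_eq].
Qed.

Lemma mxquadD n (A : 'M[R]_n) u w t : mxquad A (u + t *: w) =
  mxquad A u + t * ((u *m A *m w^T) 0 0 + (w *m A *m u^T) 0 0) + t ^+ 2 * mxquad A w.
Proof.
rewrite /mxquad linearD linearZ /= !mulmxDl !mulmxDr -!scalemxAl -!scalemxAr.
move: (u *m A *m u^T) (u *m A *m w^T) (w *m A *m u^T) (w *m A *m w^T) => a b c e.
by rewrite !mxE; ring.
Qed.

(** An isotropic vector minimizes a positive semidefinite form, so the
    derivative of the form vanishes there.  Concretely, the form is nonnegative
    at [u + t w] with [w = u A], for a small negative [t]. *)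
Lemma psd_isotropic n (A : 'M[R]_n) u : A^T = A -> (forall v, 0 <= mxquad A v) ->
  mxquad A u = 0 -> u *m A = 0.
Proof.
move=> symA psdA u0; set w := u *m A; apply/eqP; rewrite -mxquad1_eq0.
have quadD (t : R) : mxquad A (u + t *: w) =
    2 * t * mxquad 1%:M w + t ^+ 2 * mxquad A w.
  have wAu : (w *m A *m u^T) 0 0 = mxquad 1%:M w.
    by rewrite /mxquad mulmx1 -mulmxA -{1}symA -trmx_mul.
  rewrite mxquadD u0 wAu (_ : (w *m w^T) 0 0 = mxquad 1%:M w); first by ring.
  by rewrite /mxquad mulmx1.
(* any step shorter than twice the minimizer would do; the [+ 1] keeps the
   denominator positive *)
have := psdA (u + - (mxquad 1%:M w / (mxquad A w + 1)) *: w); rewrite quadD.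
have := psdA w; have := mxquad1_ge0 w.
move: (mxquad 1%:M w) (mxquad A w) => b c b0 c0 h.
have c1 : 0 < c + 1 by rewrite ltr_wpDl.
have {h} : 0 <= - (b ^+ 2 * (c + 2) / (c + 1) ^+ 2).
  by rewrite (le_trans h)// le_eqVlt; apply/orP; left; apply/eqP; field; rewrite gt_eqF.
rewrite oppr_ge0 pmulr_lle0 ?invr_gt0 ?exprn_gt0// pmulr_lle0 ?ltr_wpDl//.
by move=> b2; rewrite -sqrf_eq0 eq_le b2 sqr_ge0.
Qed.

(** The form attains its minimum [m] on the unit sphere, by compactness, at some
    [u].  Then [A - m] is positive semidefinite and isotropic at [u], so [m] is
    an eigenvalue; evaluating the form at eigenvectors shows that it is the
    smallest one. *)
Lemma rayleigh n (A : 'M[R]_n) : (0 < n)%N -> A^T = A ->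
  eigenvalue A (lambda_min A) /\
  forall v, lambda_min A * mxquad 1%:M v <= mxquad A v.
Proof.
move=> n0 symA; pose i0 := Ordinal n0.
have [||u /[!inE]/= u1 umin] := EVT_min_rV (A := [set v : 'rV[R]_n | mxquad 1%:M v = 1])
    (f := mxquad A) _ (@compact_sphere n).
- exists (delta_mx 0 i0); rewrite /= mxquad1 (bigD1 i0)//= big1 => [|j ji0].
    by rewrite !mxE !eqxx expr1n addr0.
  by rewrite !mxE (negbTE ji0) andbF expr0n.
- exact/continuous_subspaceT/continuous_mxquad.
set m := mxquad A u in umin.
have le_m v : m * mxquad 1%:M v <= mxquad A v.
  have [->|v0] := eqVneq v 0; first by rewrite /mxquad !mul0mx mxE mulr0.
  have nv : 0 < mxquad 1%:M v by rewrite lt_neqAle eq_sym mxquad1_eq0 v0 mxquad1_ge0.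
  rewrite -ler_pdivlMr//.
  have : (Num.sqrt (mxquad 1%:M v))^-1 *: v \in [set v : 'rV[R]_n | mxquad 1%:M v = 1].
    by rewrite inE /= mxquadZ exprVn sqr_sqrtr ?mxquad1_ge0// mulVf ?gt_eqF.
  by move/umin; rewrite mxquadZ exprVn sqr_sqrtr ?mxquad1_ge0// mulrC.
have eigen_m : eigenvalue A m.
  apply/eigenvalueP; exists u; last by rewrite -mxquad1_eq0 u1 oner_eq0.
  have /eqP : u *m (A - m%:M) = 0.
    apply: psd_isotropic => [|v|].
    - by rewrite linearB /= symA tr_scalar_mx.
    - by rewrite mxquadDl mxquadN mxquad_scalar subr_ge0.
    - by rewrite mxquadDl mxquadN mxquad_scalar u1 mulr1 subrr.
  by rewrite mulmxBr mul_mx_scalar subr_eq0 => /eqP.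
have lb_m x : eigenvalue A x -> m <= x.
  move=> /eigenvalueP[v vA v0]; have := le_m v; rewrite (mxquad_eigen vA) ler_pM2r//.
  by rewrite lt_neqAle eq_sym mxquad1_eq0 v0 mxquad1_ge0.
suff -> : lambda_min A = m by [].
apply/eqP; rewrite eq_le; apply/andP; split.
  by apply: ge_inf => //; exists m => x /lb_m.
by apply: lb_le_inf => [|x /lb_m//]; exists m.
Qed.

End real_symmetric_matrices.

(** * Matricization of symmetric tensors *)

Section matricization_form.
Context {R : realType} {d n : nat}.
Variables (l : 'I_#|{: Idx d n}| -> Idx d n) (linv : Idx d n -> 'I_#|{: Idx d n}|).
Hypotheses (lK : cancel l linv) (linvK : cancel linv l).
Implicit Types i j : n.-tuple 'I_d.

Lemma sort_index_sorted i :
  sorted_index [tuple of sort (relpre val leq) i].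
Proof. by rewrite /sorted_index sorted_map sort_sorted// => x y; exact: leq_total. Qed.

(** Every multi-index is a rearrangement of exactly one nondecreasing one; this
    is the position of the latter in the enumeration [l]. *)
Definition class_index i : 'I_#|{: Idx d n}| :=
  linv (exist (fun i : n.-tuple 'I_d => sorted_index i) _ (sort_index_sorted i)).

Lemma perm_eq_class_index i rho :
  (class_index i == rho) = perm_eq i (val (l rho)).
Proof.
have perm_sort : perm_eq i (val (l (class_index i))).
  by rewrite linvK /= perm_sym perm_sort.
apply/eqP/idP => [<-//|irho].
apply: (can_inj lK); apply/val_inj/val_inj/(inj_map val_inj).
apply: (sorted_eq leq_trans anti_leq).
- exact: valP (l (class_index i)).
- exact: valP (l rho).
- by apply: perm_map; apply: perm_trans irho; rewrite perm_sym.
Qed.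

Lemma class_indexK rho : class_index (val (l rho)) = rho.
Proof. by apply/eqP; rewrite perm_eq_class_index. Qed.

Lemma sum_over_classes (F : n.-tuple 'I_d -> R) :
    (forall i j, perm_eq i j -> F i = F j) ->
  \sum_i F i = \sum_rho (mult_index (val (l rho)))%:R * F (val (l rho)).
Proof.
move=> symF; rewrite (partition_big class_index predT)//=; apply: eq_bigr => rho _.
rewrite mulr_natl /mult_index -sumr_const; apply: eq_big => i.
  by rewrite perm_eq_class_index inE.
by rewrite perm_eq_class_index => /symF.
Qed.

Definition coords (xi : Ten R d n) : 'rV[R]_#|{: Idx d n}| := \row_rho xi (val (l rho)).

Definition of_coords (v : 'rV[R]_#|{: Idx d n}|) : Ten R d n :=
  [ffun i => v 0 (class_index i)].

Lemma of_coords_sym v : is_sym (of_coords v).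
Proof.
move=> s i; rewrite !ffunE; congr (v _ _); apply/eqP; rewrite perm_eq_class_index.
apply: perm_trans (perm_eq_permt s i) _.
by rewrite -perm_eq_class_index.
Qed.

Lemma of_coordsK v : coords (of_coords v) = v.
Proof. by apply/rowP => rho; rewrite mxE ffunE class_indexK. Qed.

(** Grouping equal terms produces the multiplicities in the matricization. *)
Lemma quad_form_matricize (q : Ten R d (n * 2)) (xi : Ten R d n) :
  is_sym q -> is_sym xi -> quad_form q xi = mxquad (matricize l q) (coords xi).
Proof.
move=> symq symxi; rewrite mxquadE /quad_form.
have sym_cat2 i i' j j' : perm_eq i i' -> perm_eq j j' -> q (cat2 i j) = q (cat2 i' j').
  by move=> ii' jj'; apply: is_sym_perm_eq => //; rewrite !val_tcast /= perm_cat.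
rewrite sum_over_classes => [|i i' ii']; last first.
  apply: eq_bigr => j _; rewrite (sym_cat2 _ _ _ _ ii' (perm_refl j)).
  by rewrite (is_sym_perm_eq symxi ii').
apply: eq_bigr => rho _; rewrite sum_over_classes => [|j j' jj']; last first.
  by rewrite (sym_cat2 _ _ _ _ (perm_refl _) jj') (is_sym_perm_eq symxi jj').
by rewrite mulr_sumr; apply: eq_bigr => sigma _; rewrite !mxE; ring.
Qed.

Lemma matricize_tr (q : Ten R d (n * 2)) : major_sym q ->
  (matricize l q)^T = matricize l q.
Proof. by move=> mq; apply/matrixP => rho sigma; rewrite !mxE mq; ring. Qed.

Lemma card_Idx_gt0 : (0 < d)%N -> (0 < #|{: Idx d n}|)%N.
Proof.
move=> d0; apply/card_gt0P.
have s0 := sort_index_sorted [tuple Ordinal d0 | k < n].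
by exists (exist (fun i : n.-tuple 'I_d => sorted_index i) _ s0).
Qed.

(** The smallest eigenvalue is attained, and an eigenvector is the coordinate
    vector of a nonzero symmetric tensor. *)
Lemma lambda_min_matricize_gt0 (q : Ten R d (n * 2)) : (0 < d)%N -> is_sym q ->
  (forall xi, is_sym xi -> xi != 0 -> 0 < quad_form q xi) ->
  0 < lambda_min (matricize l q).
Proof.
move=> d0 symq pdq.
have [/eigenvalueP[v vE v0] _] :=
  rayleigh (card_Idx_gt0 d0) (matricize_tr (is_sym_major symq)).
have := pdq (of_coords v) (of_coords_sym v).
rewrite quad_form_matricize ?of_coords_sym//; last exact: of_coords_sym.
rewrite of_coordsK (mxquad_eigen vE) pmulr_lgt0 => [->//|]; last first.
  by rewrite lt_neqAle eq_sym mxquad1_eq0 v0 mxquad1_ge0.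
apply: contra v0 => /eqP v0; rewrite -[v]of_coordsK v0.
by apply/eqP/rowP => k; rewrite !mxE ffunE.
Qed.

(** By the Rayleigh bound the form is at least [lambda_min q + delta lambda_min p]
    times the squared norm of the coordinates, and [delta] is the least
    nonnegative number for which this factor is nonnegative. *)
Lemma quad_form_shift_ge0 (q p : Ten R d (n * 2)) xi :
    (0 < d)%N -> is_sym q -> is_sym p -> is_sym xi ->
    0 < lambda_min (matricize l p) ->
  0 <= quad_form (q + Num.max 0 (- (lambda_min (matricize l q) /
                                    lambda_min (matricize l p))) *: p) xi.
Proof.
move=> d0 symq symp symxi lp; set delta := Num.max _ _.
have delta0 : 0 <= delta by rewrite le_max lexx.
have -> : quad_form (q + delta *: p) xi = quad_form q xi + delta * quad_form p xi.
  rewrite /quad_form mulr_sumr -big_split /=; apply: eq_bigr => i _.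
  rewrite mulr_sumr -big_split /=; apply: eq_bigr => j _.
  by rewrite !ffunE /GRing.scale /=; ring.
rewrite !quad_form_matricize//.
have N0 := card_Idx_gt0 d0.
have [_ qray] := rayleigh N0 (matricize_tr (is_sym_major symq)).
have [_ pray] := rayleigh N0 (matricize_tr (is_sym_major symp)).
have bound : 0 <= lambda_min (matricize l q) + delta * lambda_min (matricize l p).
  rewrite -lerBlDl sub0r -ler_pdivrMr// mulNr.
  by rewrite le_max lexx orbT.
apply: le_trans (lerD (qray _) (ler_wpM2l delta0 (pray _))).
by rewrite mulrA -mulrDl mulr_ge0// mxquad1_ge0.
Qed.

End matricization_form.

(** * Integration up to null sets *)

Section ae_integration.
Context d (T : measurableType d) (R : realType).
Variables (mu : {measure set T -> \bar R}) (D : set T).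
Hypothesis mD : measurable D.
Implicit Types f g : T -> R.

Lemma ae_le_integrable f g : measurable_fun D f ->
    mu.-integrable D (EFin \o g) -> {ae mu, forall x, D x -> `|f x| <= g x} ->
  mu.-integrable D (EFin \o f).
Proof.
move=> mf /integrableP[mg goo] fg; apply/integrableP; split; first exact/measurable_EFinP.
apply: le_lt_trans goo; apply: ae_ge0_le_integral => //.
- by apply: measurableT_comp => //; exact/measurable_EFinP.
- exact: measurableT_comp.
apply: filterS fg => x fg Dx /=; rewrite lee_fin (le_trans (fg Dx))//.
exact: ler_norm.
Qed.

Lemma ae_le_Rintegral f g :
    mu.-integrable D (EFin \o f) -> mu.-integrable D (EFin \o g) ->
    {ae mu, forall x, D x -> f x <= g x} ->
  \int[mu]_(x in D) f x <= \int[mu]_(x in D) g x.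
Proof.
move=> fi gi [N [mN N0 fgN]].
have DN h : mu.-integrable D (EFin \o h) ->
    \int[mu]_(x in D) h x = \int[mu]_(x in D `\` N) h x.
  by move=> hi; rewrite /Rintegral (negligible_integral mN).
have mDN : measurable (D `\` N) by exact: measurableD.
have subD : D `\` N `<=` D by move=> x [].
rewrite (DN _ fi) (DN _ gi); apply: le_Rintegral => //.
- exact: integrableS fi.
- exact: integrableS gi.
- by move=> x [Dx Nx]; apply: contrapT => fg; apply/Nx/fgN => /(_ Dx).
Qed.

Lemma ae_eq_Rintegral f g :
    mu.-integrable D (EFin \o f) -> mu.-integrable D (EFin \o g) ->
    {ae mu, forall x, D x -> f x = g x} ->
  \int[mu]_(x in D) f x = \int[mu]_(x in D) g x.
Proof.
move=> fi gi fg; apply/eqP; rewrite eq_le; apply/andP.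
by split; apply: ae_le_Rintegral => //; apply: filterS fg => x fg /fg ->.
Qed.

Lemma Rintegrable_sum I (s : seq I) (f : I -> T -> R) :
    (forall i, mu.-integrable D (EFin \o f i)) ->
  mu.-integrable D (EFin \o (fun x => \sum_(i <- s) f i x)).
Proof.
move=> fi; rewrite (_ : _ \o _ = fun x => (\sum_(i <- s) (f i x)%:E)%E).
  by apply: integrable_sum => // i _; exact: fi.
by apply/funext => x /=; rewrite sumEFin.
Qed.

Lemma Rintegral_sum I (s : seq I) (f : I -> T -> R) :
    (forall i, mu.-integrable D (EFin \o f i)) ->
  \int[mu]_(x in D) (\sum_(i <- s) f i x) = \sum_(i <- s) \int[mu]_(x in D) f i x.
Proof.
move=> fi; elim: s => [|i s IHs].
  by under eq_Rintegral do rewrite big_nil; rewrite Rintegral_cst// mul0r big_nil.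
under eq_Rintegral do rewrite big_cons.
by rewrite RintegralD// ?big_cons ?IHs//; exact: Rintegrable_sum.
Qed.

Lemma RintegrableZl f r : mu.-integrable D (EFin \o f) ->
  mu.-integrable D (EFin \o (fun x => r * f x)).
Proof. by move=> fi; exact: (integrableZl mD r fi). Qed.

Lemma RintegrableD f g :
    mu.-integrable D (EFin \o f) -> mu.-integrable D (EFin \o g) ->
  mu.-integrable D (EFin \o (fun x => f x + g x)).
Proof. by move=> fi gi; exact: (integrableD mD fi gi). Qed.

Lemma RintegrableB f g :
    mu.-integrable D (EFin \o f) -> mu.-integrable D (EFin \o g) ->
  mu.-integrable D (EFin \o (fun x => f x - g x)).
Proof. by move=> fi gi; exact: (integrableB mD fi gi). Qed.

End ae_integration.

(** * The volume of the periodicity cell *)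

Section cell_measure.
Context {R : realType}.

Lemma cell_bigcap d (ell : 'I_d -> R) :
  cell ell = \bigcap_(i in [set: 'I_d])
    ((fun y : Rn R d => tnth y i : R) @^-1` `]0, ell i[%classic).
Proof.
apply/seteqP; split => y /= yY i; first by move=> _ /=; rewrite in_itv /= yY.
by have := yY i Logic.I; rewrite /= in_itv.
Qed.

Lemma measurable_cell d (ell : 'I_d -> R) : measurable (cell ell).
Proof.
rewrite cell_bigcap; apply: fin_bigcap_measurable => // i _.
rewrite -[X in measurable X]setTI; apply: measurable_tnth => //.
Qed.

Lemma lebesgueRn_cell d (ell : 'I_d -> R) : (forall i, 0 < ell i) ->
  lebesgueRn R d (cell ell) = (cell_volume ell)%:E.
Proof.
elim: d ell => [|d IHd] ell ell0.
  by rewrite /cell_volume big_ord0 /= diracE mem_set// => -[].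
rewrite /cell_volume big_ord_recl EFinM -[X in (_ * X)%E]IHd// /= /lebesgue_cons /pushforward.
rewrite (_ : _ @^-1` _ = `]0, ell ord0[%classic `*` cell (fun i => ell (lift ord0 i))).
  rewrite product_measure1E//; last exact: measurable_cell.
  have := @lebesgue_measure_itv R `]0, ell ord0[; rewrite /= lte_fin ell0 oppr0 adde0 => volI.
  by congr (_ * _)%E.
apply/seteqP; split => -[t v] /=.
  move=> tvY; split; first by have := tvY ord0; rewrite /= in_itv tnth0.
  by move=> i; have := tvY (lift ord0 i); rewrite tnthS.
move=> [t0 vY] i; case: (unliftP ord0 i) => [j|] ->.
  by rewrite tnthS; exact: vY.
by rewrite tnth0; move: t0; rewrite in_itv.
Qed.

End cell_measure.

(** * Bounds for elliptic matrices *)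

Section dot_products.
Context {R : realType} {d : nat}.
Implicit Types (x y z : 'cV[R]_d) (M : 'M[R]_d).

Lemma dotvC x y : dotv x y = dotv y x.
Proof. by apply: eq_bigr => i _; rewrite mulrC. Qed.

Lemma dotvDr x y z : dotv x (y + z) = dotv x y + dotv x z.
Proof. by rewrite /dotv -big_split; apply: eq_bigr => i _; rewrite mxE mulrDr. Qed.

Lemma dotvDl x y z : dotv (x + y) z = dotv x z + dotv y z.
Proof. by rewrite dotvC dotvDr !(dotvC z). Qed.

Lemma dotvNr x y : dotv x (- y) = - dotv x y.
Proof. by rewrite /dotv -sumrN; apply: eq_bigr => i _; rewrite mxE mulrN. Qed.

Lemma dotvNl x y : dotv (- x) y = - dotv x y.
Proof. by rewrite dotvC dotvNr dotvC. Qed.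

Lemma dotvZr (c : R) x y : dotv x (c *: y) = c * dotv x y.
Proof. by rewrite /dotv mulr_sumr; apply: eq_bigr => i _; rewrite mxE mulrCA. Qed.

Lemma dotv_sumr I (s : seq I) x (f : I -> 'cV[R]_d) :
  dotv x (\sum_(i <- s) f i) = \sum_(i <- s) dotv x (f i).
Proof.
elim: s => [|i s IHs]; last by rewrite !big_cons dotvDr IHs.
by rewrite !big_nil /dotv big1// => k _; rewrite mxE mulr0.
Qed.

Lemma dotv_ge0 x : 0 <= dotv x x.
Proof. by apply: sumr_ge0 => i _; rewrite -expr2 sqr_ge0. Qed.

Lemma dotv_mulmx M x y : dotv (M *m x) y = dotv x (M^T *m y).
Proof.
rewrite /dotv; under eq_bigr do rewrite mxE mulr_suml.
under [RHS]eq_bigr do rewrite mxE mulr_sumr.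
by rewrite exchange_big; apply: eq_bigr => i _; apply: eq_bigr => j _; rewrite mxE; ring.
Qed.

(** Polarization: the form of [M] is nonnegative at [x + y] and at [x - y]. *)
Lemma elliptic_bound M (lambda Lambda : R) x y : M^T = M -> 0 < lambda ->
    (forall z, lambda * dotv z z <= dotv (M *m z) z <= Lambda * dotv z z) ->
  `|dotv (M *m x) y| <= Lambda * (dotv x x + dotv y y).
Proof.
move=> symM lambda0 bndM.
have psd z : 0 <= dotv (M *m z) z.
  by case/andP: (bndM z) => + _; apply: le_trans; rewrite mulr_ge0 ?dotv_ge0// ltW.
have /andP[_ bx] := bndM x; have /andP[_ bY] := bndM y.
have yx : dotv (M *m y) x = dotv (M *m x) y by rewrite dotv_mulmx symM dotvC.
have := psd (x + y); rewrite mulmxDr dotvDl !dotvDr yx => pD.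
have := psd (x - y); rewrite mulmxBr dotvDl !dotvDr !dotvNl !dotvNr yx => pB.
have := psd x; have := psd y => py px.
by rewrite ler_norml; apply/andP; split; lra.
Qed.

End dot_products.

(** * The energy form on square integrable fields *)

Section square_integrable_fields.
Context {R : realType} {d : nat}.
Variable ell : 'I_d -> R.
Hypothesis ell0 : forall i, 0 < ell i.
Implicit Types (u w : Rn R d -> R) (F G : Rn R d -> 'cV[R]_d).

Local Notation mu := (lebesgueRn R d).
Local Notation Y := (cell ell).
Local Notation integrableY f := (mu.-integrable Y (EFin \o f)).

Lemma cell_volume_gt0 : 0 < cell_volume ell.
Proof. exact: prodr_gt0. Qed.

Lemma Rintegral_cell_cst (c : R) : \int[mu]_(y in Y) c = c * cell_volume ell.
Proof.
rewrite Rintegral_cst//; last exact: measurable_cell.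
by rewrite [X in fine X](lebesgueRn_cell ell0).
Qed.

Lemma integrableY_cst (c : R) : integrableY (fun=> c).
Proof.
apply/integrableP; split; first exact/measurable_EFinP.
rewrite /= integral_cst//; last exact: measurable_cell.
by rewrite [X in (_ * X)%E](lebesgueRn_cell ell0) -EFinM ltry.
Qed.

Lemma in_L2_sqr u : in_L2 ell u -> integrableY (fun y => u y ^+ 2).
Proof.
move=> [mu2 u2]; apply/integrableP; split.
  by apply/measurable_EFinP; exact: measurable_funX.
by under eq_integral do rewrite /= ger0_norm ?sqr_ge0//.
Qed.

Lemma in_L2P u : measurable_fun Y u -> integrableY (fun y => u y ^+ 2) -> in_L2 ell u.
Proof.
move=> mfu /integrableP[_ u2]; split => //; apply: le_lt_trans u2.
by under [leRHS]eq_integral do rewrite /= ger0_norm ?sqr_ge0//.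
Qed.

Lemma in_L2M u w : in_L2 ell u -> in_L2 ell w -> integrableY (fun y => u y * w y).
Proof.
move=> uL wL; have [mfu _] := uL; have [mfw _] := wL.
apply: (@ae_le_integrable _ _ _ mu Y (measurable_cell ell) _
  (fun y => u y ^+ 2 + w y ^+ 2)).
- exact: measurable_funM.
- exact: (RintegrableD (measurable_cell ell) (in_L2_sqr uL) (in_L2_sqr wL)).
apply: aeW => y _; rewrite ler_norml; apply/andP.
by have := sqr_ge0 (u y + w y); have := sqr_ge0 (u y - w y); rewrite !expr2; split; nra.
Qed.

Lemma in_L2D u w : in_L2 ell u -> in_L2 ell w -> in_L2 ell (fun y => u y + w y).
Proof.
move=> uL wL; have [mfu _] := uL; have [mfw _] := wL.
apply: in_L2P; first exact: measurable_funD.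
rewrite (_ : (fun _ => _) = fun y => (u y ^+ 2 + w y ^+ 2) + 2 * (u y * w y)).
  apply: RintegrableD; [exact: measurable_cell| |].
    exact: (RintegrableD (measurable_cell ell) (in_L2_sqr uL) (in_L2_sqr wL)).
  by apply: RintegrableZl; [exact: measurable_cell|exact: in_L2M].
by apply/funext => y; ring.
Qed.

Lemma in_L2Z (c : R) u : in_L2 ell u -> in_L2 ell (fun y => c * u y).
Proof.
move=> uL; have [mfu _] := uL.
apply: in_L2P; first by apply: measurable_funM.
rewrite (_ : (fun _ => _) = fun y => c ^+ 2 * u y ^+ 2).
  by apply: RintegrableZl; [exact: measurable_cell|exact: in_L2_sqr].
by apply/funext => y; rewrite exprMn.
Qed.

Lemma in_L2_cst (c : R) : in_L2 ell (fun=> c).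
Proof. by apply: in_L2P => //; exact: integrableY_cst. Qed.

Definition in_L2v F : Prop := forall i, in_L2 ell (fun y => F y i 0).

Lemma in_L2v_int F : in_L2v F -> forall i, integrableY (fun y => F y i 0).
Proof.
move=> FL i; have := in_L2M (FL i) (in_L2_cst 1).
by under eq_fun do rewrite mulr1.
Qed.

Lemma in_L2v_cst (x : 'cV[R]_d) : in_L2v (fun=> x).
Proof. by move=> i; exact: in_L2_cst. Qed.

Lemma in_L2vD F G : in_L2v F -> in_L2v G -> in_L2v (fun y => F y + G y).
Proof. by move=> FL GL i; under eq_fun do rewrite mxE; exact: in_L2D. Qed.

Lemma in_L2vZ (c : R) F : in_L2v F -> in_L2v (fun y => c *: F y).
Proof. by move=> FL i; under eq_fun do rewrite mxE; exact: in_L2Z. Qed.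

Lemma in_L2v_sum I (s : seq I) (F : I -> Rn R d -> 'cV[R]_d) :
  (forall i, in_L2v (F i)) -> in_L2v (fun y => \sum_(i <- s) F i y).
Proof.
move=> FL; elim: s => [|i s IHs]; under eq_fun do rewrite ?big_nil ?big_cons.
  exact: in_L2v_cst.
exact: in_L2vD.
Qed.

Lemma dotv_integrable F G : in_L2v F -> in_L2v G ->
  integrableY (fun y => dotv (F y) (G y)).
Proof.
by move=> FL GL; apply: Rintegrable_sum => [|i]; [exact: measurable_cell|exact: in_L2M].
Qed.

Variables (lambda Lambda : R) (a : Rn R d -> 'M[R]_d).
Hypotheses (lambda0 : 0 < lambda) (elliptic_a : elliptic_periodic ell lambda Lambda a).

(** The coefficients of [a] are bounded only almost everywhere; the bound comes
    from [elliptic_bound]. *)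
Lemma energy_integrable F G : in_L2v F -> in_L2v G ->
  integrableY (fun y => dotv (a y *m F y) (G y)).
Proof.
move=> FL GL; have [ma syma _ bnda] := elliptic_a.
apply: (@ae_le_integrable _ _ _ mu Y (measurable_cell ell) _
  (fun y => Lambda * (dotv (F y) (F y) + dotv (G y) (G y)))).
- apply: measurable_sum => i; apply: measurable_funM; last by have [] := GL i.
  under eq_fun do rewrite mxE; apply: measurable_sum => k.
  apply: measurable_funM; last by have [] := FL k.
  exact: measurable_funTS.
- apply: RintegrableZl; first exact: measurable_cell.
  apply: (RintegrableD (measurable_cell ell) (dotv_integrable FL FL) (dotv_integrable GL GL)).
by near=> y => _; apply: elliptic_bound lambda0 _; near: y.
Unshelve. all: by end_near. Qed.

Definition energy F G : R := innerv ell (fun y => a y *m F y) G.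

Lemma energyC F G : in_L2v F -> in_L2v G -> energy F G = energy G F.
Proof.
move=> FL GL; have [_ syma _ _] := elliptic_a.
apply: ae_eq_Rintegral; try exact: energy_integrable; first exact: measurable_cell.
by apply: filterS syma => y symy _; rewrite dotv_mulmx symy dotvC.
Qed.

Lemma energyDr F G1 G2 : in_L2v F -> in_L2v G1 -> in_L2v G2 ->
  energy F (fun y => G1 y + G2 y) = energy F G1 + energy F G2.
Proof.
move=> FL GL1 GL2; rewrite /energy /innerv; under eq_Rintegral do rewrite dotvDr.
by rewrite RintegralD//; [exact: measurable_cell|exact: energy_integrable..].
Qed.

Lemma energyZr (c : R) F G : in_L2v F -> in_L2v G ->
  energy F (fun y => c *: G y) = c * energy F G.
Proof.
move=> FL GL; rewrite /energy /innerv; under eq_Rintegral do rewrite dotvZr.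
by rewrite RintegralZl//; [exact: measurable_cell|exact: energy_integrable].
Qed.

Lemma energy_sumr I (s : seq I) F (G : I -> Rn R d -> 'cV[R]_d) :
    in_L2v F -> (forall i, in_L2v (G i)) ->
  energy F (fun y => \sum_(i <- s) G i y) = \sum_(i <- s) energy F (G i).
Proof.
move=> FL GL; rewrite /energy /innerv; under eq_Rintegral do rewrite dotv_sumr.
by apply: Rintegral_sum => [|i]; [exact: measurable_cell|exact: energy_integrable].
Qed.

(** Jensen's inequality in elementary form: integrate
    [|F|^2 >= 2 x . F - |x|^2]. *)
Lemma energy_ge F (x : 'cV[R]_d) : in_L2v F ->
    (forall i, \int[mu]_(y in Y) F y i 0 = x i 0 * cell_volume ell) ->
  lambda * dotv x x * cell_volume ell <= energy F F.
Proof.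
move=> FL meanF; have [_ _ _ bnda] := elliptic_a; have mY := measurable_cell ell.
have iFx : integrableY (fun y => dotv x (F y)).
  by apply: dotv_integrable => //; exact: in_L2v_cst.
have iFx2 : integrableY (fun y => 2 * dotv x (F y) - dotv x x).
  by apply: RintegrableB => //; [exact: RintegrableZl|exact: integrableY_cst].
have intFx : \int[mu]_(y in Y) dotv x (F y) = dotv x x * cell_volume ell.
  rewrite Rintegral_sum//= => [|i]; last first.
    by apply: RintegrableZl => //; exact: in_L2v_int.
  rewrite mulr_suml; apply: eq_bigr => i _.
  by rewrite RintegralZl// ?meanF ?mulrA//; exact: in_L2v_int.
have -> : lambda * dotv x x * cell_volume ell =
    \int[mu]_(y in Y) (lambda * (2 * dotv x (F y) - dotv x x)).
  rewrite RintegralZl// RintegralB//; [|exact: RintegrableZl|exact: integrableY_cst].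
  by rewrite RintegralZl// intFx Rintegral_cell_cst; ring.
apply: ae_le_Rintegral => //; [exact: RintegrableZl|exact: energy_integrable|].
apply: filterS bnda => y /(_ (F y))/andP[lb _] _; apply: le_trans lb.
rewrite ler_pM2l//; have := dotv_ge0 (F y - x).
by rewrite dotvDl !dotvDr !dotvNl !dotvNr (dotvC (F y) x); lra.
Qed.

End square_integrable_fields.

(** * The homogenized matrix is symmetric positive definite *)

Section homogenized_matrix.
Context {R : realType} {d : nat}.
Variable ell : 'I_d -> R.
Hypothesis ell0 : forall i, 0 < ell i.

Lemma H1per_grad u : H1per ell u -> is_grad ell u (grad ell u).
Proof. by move=> [_ exG]; exact: xgetPex. Qed.

Lemma partials_cst (s : seq 'I_d) (c : R) : exists c', partials s (cst c) = cst c'.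
Proof.
elim: s => [|i s [c' IHs]]; first by exists c.
by exists 0; rewrite /= IHs; apply/funext => x; exact: derive_cst.
Qed.

(** Test the definition of the weak gradient against the constant function 1,
    which is periodic. *)
Lemma mean_grad u G : is_grad ell u G ->
  forall i, \int[lebesgueRn R d]_(y in cell ell) G y i 0 = 0.
Proof.
move=> [_ ibp] i.
have smooth1 : smooth (cst 1 : 'rV[R]_d -> R).
  move=> s; have [c ->] := partials_cst s 1; split => [x|j x].
    exact: cst_continuous.
  exact: derivable_cst.
have := ibp _ smooth1 (fun _ _ => erefl) i; rewrite /inner.
under eq_Rintegral do rewrite [partial _ _ _]derive_cst mulr0.
under [X in _ = - X]eq_Rintegral do rewrite mulr1.
by rewrite Rintegral_cell_cst// mul0r => /esym/eqP; rewrite oppr_eq0 => /eqP.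
Qed.

Variables (lambda Lambda : R) (a : Rn R d -> 'M[R]_d).
Hypotheses (lambda0 : 0 < lambda) (elliptic_a : elliptic_periodic ell lambda Lambda a).
Variable chi : forall k : nat, Rn R d -> Ten R d k.
Hypothesis corr : correctors ell a chi.

Definition grad_chi (j : 'I_d) := grad ell (chi_comp chi [tuple j]).

Definition cell_flow (j : 'I_d) : Rn R d -> 'cV[R]_d :=
  fun y => grad_chi j y + basis_vec j.

Lemma is_grad_chi j : is_grad ell (chi_comp chi [tuple j]) (grad_chi j).
Proof. by have [_ /(_ [tuple j])[[h1 _] _] _] := corr; exact: H1per_grad. Qed.

Lemma grad_chi_L2 j : in_L2v ell (grad_chi j).
Proof. by have [] := is_grad_chi j. Qed.

Lemma cell_flow_L2 j : in_L2v ell (cell_flow j).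
Proof. by apply: in_L2vD => //; [exact: grad_chi_L2|exact: in_L2v_cst]. Qed.

Lemma mean_cell_flow j i :
  \int[lebesgueRn R d]_(y in cell ell) cell_flow j y i 0 =
  (basis_vec j : 'cV[R]_d) i 0 * cell_volume ell.
Proof.
under eq_Rintegral do rewrite mxE.
rewrite RintegralD ?(mean_grad (is_grad_chi j)) ?add0r ?Rintegral_cell_cst//.
- exact: measurable_cell.
- by apply: in_L2v_int => //; exact: grad_chi_L2.
- exact: integrableY_cst.
Qed.

(** The cell problem for [chi_j], tested with [chi_i]. *)
Lemma energy_flow_grad i j : energy ell a (cell_flow j) (grad_chi i) = 0.
Proof.
have [_ corr1 _] := corr.
have [Wi _] := corr1 [tuple i]; have [_ /(_ _ Wi)] := corr1 [tuple j].
rewrite theadE -/(grad_chi i) -/(grad_chi j) => weak.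
rewrite (energyC lambda0 elliptic_a (cell_flow_L2 j) (grad_chi_L2 i)).
rewrite [LHS](energyDr lambda0 elliptic_a (grad_chi_L2 i) (grad_chi_L2 j));
  last exact: in_L2v_cst.
rewrite !(energyC lambda0 elliptic_a (grad_chi_L2 i)); [|exact: in_L2v_cst|exact: grad_chi_L2].
by rewrite /energy weak addNr.
Qed.

Local Notation a0 := (gT ell a chi 0 : Ten R d 2).

(** By orthogonality the test field [e_i] may be completed into the full cell
    flow, which makes the formula symmetric. *)
Lemma a0E (i : 2.-tuple 'I_d) :
  a0 i = (cell_volume ell)^-1 *
    energy ell a (cell_flow (tnth i (lift ord0 ord0))) (cell_flow (tnth i ord0)).
Proof.
set i1 := tnth i ord0; set i2 := tnth i (lift ord0 ord0).
rewrite ffunE; congr (_ * _).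
transitivity (energy ell a (cell_flow i2) (fun=> basis_vec i1)).
  apply: eq_Rintegral => y _; congr dotv; rewrite /flux /thead; congr (_ *m _).
  have -> : tail i = [tuple i2].
    case/tupleP: i @i1 @i2 => x i; case/tupleP: i => z i.
    by apply: val_inj; rewrite /= (tuple0 i) /= (tnth_nth x).
  by have [chi0 _ _] := corr; rewrite /chi_comp chi0 scale1r tnth0.
rewrite /cell_flow [RHS](energyDr lambda0 elliptic_a (cell_flow_L2 i2)).
- by rewrite energy_flow_grad add0r.
- exact: grad_chi_L2.
- exact: in_L2v_cst.
Qed.

Definition homogenized_mx : 'M[R]_d := \matrix_(i, j) a0 [tuple i; j].

Lemma homogenized_mxE i j : homogenized_mx i j =
  (cell_volume ell)^-1 * energy ell a (cell_flow j) (cell_flow i).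
Proof. by rewrite mxE a0E !(tnth_nth i). Qed.

Lemma homogenized_mx_sym : homogenized_mx^T = homogenized_mx.
Proof.
apply/matrixP => i j; rewrite mxE !homogenized_mxE; congr (_ * _).
by apply: (energyC lambda0 elliptic_a); exact: cell_flow_L2.
Qed.

Lemma homogenized_mx_pos_def : pos_def homogenized_mx.
Proof.
move=> v v0; pose F y := \sum_j v 0 j *: cell_flow j y.
have vFL j : in_L2v ell (fun y => v 0 j *: cell_flow j y).
  by apply: in_L2vZ => //; exact: cell_flow_L2.
have FL : in_L2v ell F by exact: in_L2v_sum.
have quadE : mxquad homogenized_mx v = (cell_volume ell)^-1 * energy ell a F F.
  rewrite mxquadE (energy_sumr lambda0 elliptic_a _ FL vFL) mulr_sumr.
  apply: eq_bigr => i _; rewrite (energyZr lambda0 elliptic_a)//; last exact: cell_flow_L2.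
  rewrite (energyC lambda0 elliptic_a FL (cell_flow_L2 i)).
  rewrite (energy_sumr lambda0 elliptic_a _ (cell_flow_L2 i) vFL) !mulr_sumr.
  apply: eq_bigr => j _; rewrite (energyZr lambda0 elliptic_a)//; try exact: cell_flow_L2.
  rewrite homogenized_mxE (energyC lambda0 elliptic_a (cell_flow_L2 i) (cell_flow_L2 j)).
  by ring.
have meanF i : \int[lebesgueRn R d]_(y in cell ell) F y i 0 = v^T i 0 * cell_volume ell.
  under eq_Rintegral do rewrite summxE.
  have mY := measurable_cell ell.
  rewrite Rintegral_sum// => [|j]; last exact: in_L2v_int.
  rewrite mxE (bigD1 i)//= big1 ?addr0 => [|j ji]; under eq_Rintegral do rewrite mxE;
    rewrite RintegralZl ?mean_cell_flow// ?mxE ?eqxx ?mul1r//;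
    try (by apply: in_L2v_int => //; exact: cell_flow_L2).
  by rewrite eq_sym (negbTE ji) mul0r mulr0.
have V0 := cell_volume_gt0 ell0.
rewrite quadE mulr_gt0 ?invr_gt0//.
apply: lt_le_trans (energy_ge ell0 lambda0 elliptic_a FL meanF).
rewrite !mulr_gt0// lt_neqAle dotv_ge0 andbT eq_sym.
apply: contra v0; rewrite /dotv psumr_eq0 => [/allP vv0|i _]; last by rewrite -expr2 sqr_ge0.
apply/eqP/rowP => i; have := vv0 i (mem_index_enum _).
by rewrite /= !mxE -expr2 sqrf_eq0 => /eqP.
Qed.

Lemma homogenized_factorization : exists2 B : 'M[R]_d, B \in unitmx &
  forall i, a0 i = (B^T *m B) (tnth i ord0) (tnth i (lift ord0 ord0)).
Proof.
have [B Bu AB] := cholesky homogenized_mx_sym homogenized_mx_pos_def.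
by exists B => // i; rewrite -AB homogenized_mxE a0E.
Qed.

End homogenized_matrix.

(** * The positive semidefinite correction *)

Theorem lemma3p2 (R : realType) (d : nat) (ell : 'I_d -> R)
    (lambda Lambda : R) (a : Rn R d -> 'M[R]_d)
    (chi : forall k : nat, Rn R d -> Ten R d k)
    (alpha : R) (r : nat)
    (aa c : forall s : nat, Ten R d (s.+1 * 2))
    (bb : forall s : nat, Ten R d (s * 2))
    (l : 'I_#|{: Idx d r.+1}| -> Idx d r.+1) :
  (0 < d)%N -> (forall i, 0 < ell i) ->
  0 < lambda -> 0 < Lambda -> elliptic_periodic ell lambda Lambda a ->
  correctors ell a chi ->
  2 <= alpha -> (1 <= r)%N -> r%:Z <= Num.floor (alpha / 2) ->
  let g := gT ell a chi in
  let a0 : Ten R d 2 := g 0%N in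
  c_tensors g c aa bb r ->
  (forall s, (1 <= s <= r.-1)%N -> requirements g c bb (aa s) (bb s)) ->
  bijective l ->
  let q := q_check g c bb r in
  let Ar := matricize l (symT (tenpow a0 r.+1)) in
  let delta := Num.max 0 (- (lambda_min (matricize l q) / lambda_min Ar)) in
  let RR : Ten R d (r * 2) := delta *: symT (tenpow a0 r) in
  let ar : Ten R d (r.+1 * 2) := q + symT (castT (ba_order r) (otimes RR a0)) in
  let br : Ten R d (r * 2) := RR in
  requirements g c bb ar br.
Proof.
move=> d0 ell0 lambda0 _ ella corr _ _ _ g a0 _ _ [linv lK linvK] q Ar delta RR ar br.
have [B Bu a0B] := homogenized_factorization ell0 lambda0 ella corr.
have symq : is_sym q by exact: symT_is_sym.
have delta0 : 0 <= delta by rewrite le_max lexx.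
have pd n xi : is_sym xi -> xi != 0 -> 0 < quad_form (symT (tenpow a0 n)) xi.
  exact: (quad_form_tenpow_gt0 Bu a0B).
have arE : ar = q + delta *: symT (tenpow a0 r.+1).
  by rewrite /ar /RR otimesZl castTZ symTZ symT_tenpow_left.
have sym_ar : is_sym ar.
  by rewrite arE -[q]symT_id// -symTZ -symTD; exact: symT_is_sym.
have sym_br : is_sym br.
  by rewrite /br /RR -symTZ; exact: symT_is_sym.
split.
- split=> [xi symxi|xi symxi]; rewrite -/(quad_form _ xi).
    rewrite arE; apply: (quad_form_shift_ge0 lK linvK) => //; first exact: symT_is_sym.
    by apply: (lambda_min_matricize_gt0 lK linvK) => //; [exact: symT_is_sym|exact: pd].
  have -> : quad_form br xi = delta * quad_form (symT (tenpow a0 r)) xi.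
    rewrite /quad_form mulr_sumr; apply: eq_bigr => i _; rewrite mulr_sumr.
    by apply: eq_bigr => j _; rewrite [br _]ffunE /GRing.scale /=; ring.
  have [->|xi0] := eqVneq xi 0; last by rewrite mulr_ge0// ltW// pd.
  rewrite /quad_form big1 ?mulr0// => i _; rewrite big1// => j _.
  by rewrite !ffunE mulr0.
- by split; exact: is_sym_major.
- apply: etrans (symTB ar _) _.
  by rewrite /ar symTD symT_idem addrK symT_id.
Qed.
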